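(* Let $\Gamma$ be an inverse $\widetilde{A}$-digraph and $x_0\in V(\Gamma)$. The following conditions are equivalent: (1) for any non-empty finite set $F\subseteq V(\Gamma)$ the language $L(\Gamma,x_0,F)$ is context-free; (2) the language $L(\Gamma,x_0)$ is context-free; (3) the rooted graph $(\Gamma,x_0)$ is context-free in the sense of Muller–Schupp; (4) there exists an inverse PDA $M$ with initial state $q_0$ and initial stack symbol $\perp$ such that the rooted configurations graph $(\Gamma(M),(q_0,\perp))$ is isomorphic to $(\Gamma,x_0)$; (5) for any vertex $y_0\in V(\Gamma)$, the rooted graph $(\Gamma,y_0)$ is context-free in the sense of Muller–Schupp.
   Context: $A$ is a finite set, $\widetilde{A}=A\cup A^{-1}$ with $A^{-1}$ a disjoint set of formal inverses. An inverse $\widetilde{A}$-digraph (inverse graph) consists of vertices $V(\Gamma)$, oriented edges $E(\Gamma)$ with initial and terminal maps $\iota,\tau$, a labeling $\lambda:E(\Gamma)\to\widetilde{A}$, and an involution $e\mapsto e^{-1}$ with $e\neq e^{-1}$, $\iota(e^{-1})=\tau(e)$, $\tau(e^{-1})=\iota(e)$, $\lambda(e^{-1})=\lambda(e)^{-1}$, such that $\Gamma$ is connected and deterministic (at most one edge with a given label starts at a given vertex). Morphisms commute with $\iota,\tau,\lambda$ and the involution; an isomorphism of rooted graphs also maps root to root. $L(\Gamma,x_0,F)$ is the set of labels of walks from $x_0$ to a vertex of $F$, and $L(\Gamma,x_0)=L(\Gamma,x_0,\{x_0\})$. Muller–Schupp context-freeness: let $d$ be the path distance and $\|y\|_{x_0}=d(x_0,y)$.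 For a vertex $v$ with $\|v\|_{x_0}=n$, the end-cone $\Gamma(v,x_0)$ is the connected component containing $v$ of the full subgraph of $\Gamma$ on the vertices $y$ with $\|y\|_{x_0}\ge n$; its frontier is $\Delta(v,x_0)=\{y\in\Gamma(v,x_0):\|y\|_{x_0}=n\}$. An end-isomorphism $\Gamma(v,x_0)\to\Gamma(w,x_0)$ is an isomorphism of (labeled, involutive) graphs mapping $\Delta(v,x_0)$ onto $\Delta(w,x_0)$. $(\Gamma,x_0)$ is context-free in the sense of Muller–Schupp if there are finitely many end-cones $\Gamma(v,x_0)$ up to end-isomorphism. Pushdown automata: a real-time deterministic PDA over $\widetilde{A}$ is a tuple $M=(Q,\widetilde{A},\Theta,\delta,q_0,\perp,F)$ with finite state set $Q$, finite stack alphabet $\Theta\ni\perp$, initial state $q_0$, initial stack symbol $\perp$, final states $F\subseteq Q$, and a partial function $\delta$ from $Q\times\widetilde{A}\times\Theta$ to $Q\times\Theta^*$ (there are no transitions reading the empty word). If $\delta(q,a,x)=(p,\gamma)$ then for all $\xi\in\Theta^*$ there is a step $(q,\xi x)\vdash_a(p,\xi\gamma)$ (the top of the stack is on the right). The configurations graph $\Gamma(M)$ has as vertices the pairs in $Q\times\Theta^*$ reachable from $(q_0,\perp)$ by finitely many steps, and an edge $(q_1,\xi_1)\to(q_2,\xi_2)$ labeled $a$ for each step $(q_1,\xi_1)\vdash_a(q_2,\xi_2)$. $M$ is inverse if its steps on letters $a\in A$ and on letters of $A^{-1}$ reverse each other: for $a\in A$, $(q_1,\xi_1)\vdash_a(q_2,\xi_2)$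 if and only if $(q_2,\xi_2)\vdash_{a^{-1}}(q_1,\xi_1)$, for configurations in $\Gamma(M)$; equivalently, $\Gamma(M)$ is an inverse graph (with the inverse of an edge being its reversal). *)

(* Defs.v *)
From Stdlib Require Import Relation_Operators Operators_Properties.
From mathcomp Require Import all_boot.
From mathcomp Require Import boolp classical_sets functions cardinality.

Set Implicit Arguments.
Unset Strict Implicit.
Unset Printing Implicit Defensive.

Local Open Scope classical_set_scope.

(* The alphabet A ∪ A^-1: [inl a] is the letter a, [inr a] its formal inverse. *)
Definition letter (A : finType) : finType := (A + A)%type.

Definition letter_inv (A : finType) (a : letter A) : letter A :=
  match a with inl x => inr x | inr x => inl x end.

(* Involutive labelled digraphs, with no connectedness or determinism assumed,
   so that arbitrary full subgraphs are again objects of this type. *)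
Record invol_digraph (A : finType) := InvolDigraph {
  vertex :> Type;
  edge : Type;
  src : edge -> vertex;
  tgt : edge -> vertex;
  lab : edge -> letter A;
  einv : edge -> edge;
  einvK : involutive einv;
  einv_neq : forall e, e <> einv e;
  src_einv : forall e, src (einv e) = tgt e;
  tgt_einv : forall e, tgt (einv e) = src e;
  lab_einv : forall e, lab (einv e) = letter_inv (lab e)
}.

Fixpoint walk (A : finType) (G : invol_digraph A) (x : G) (p : seq (edge G))
    (y : G) : Prop :=
  match p with
  | [::] => x = y
  | e :: p' => src e = x /\ walk (tgt e) p' y
  end.

Lemma walk_cat (A : finType) (G : invol_digraph A) (x y z : G) p q :
  walk x p y -> walk y q z -> walk x (p ++ q) z.
Proof.
by elim: p x => [|e p IH] x /= => [-> //|[-> /IH xy /xy]].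
Qed.

Lemma walk_sym (A : finType) (G : invol_digraph A) (x y : G) p :
  walk x p y -> exists q, walk y q x.
Proof.
elim: p x => [|e p IH] x /=; first by exists [::].
move=> [<- /IH[q yq]]; exists (q ++ [:: einv e]).
by apply: walk_cat yq _; rewrite /= src_einv tgt_einv.
Qed.

(* Because of the edge involution, connectedness by oriented walks is the same
   as connectedness of the underlying undirected graph. *)
Record inverse_graph (A : finType) := InverseGraph {
  base_graph :> invol_digraph A;
  connected : forall x y : base_graph, exists p, walk x p y;
  deterministic : forall e f : edge base_graph,
    src e = src f -> lab e = lab f -> e = f
}.

Record graph_iso (A : finType) (G H : invol_digraph A) := GraphIso {
  iso_vertex :> G -> H;
  iso_edge : edge G -> edge H;
  iso_src : forall e, src (iso_edge e) = iso_vertex (src e);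
  iso_tgt : forall e, tgt (iso_edge e) = iso_vertex (tgt e);
  iso_lab : forall e, lab (iso_edge e) = lab e;
  iso_einv : forall e, iso_edge (einv e) = einv (iso_edge e);
  iso_vertex_bij : bijective iso_vertex;
  iso_edge_bij : bijective iso_edge
}.

Definition rooted_isomorphic (A : finType) (G : invol_digraph A) (x : G)
    (H : invol_digraph A) (y : H) : Prop :=
  exists f : graph_iso G H, f x = y.

Definition walk_lang (A : finType) (G : invol_digraph A) (x0 : G) (F : set G) :
    set (seq (letter A)) :=
  [set w | exists y p, [/\ F y, walk x0 p y & w = map (@lab A G) p]].

Record cfg (T : finType) := Cfg {
  nonterminal : finType;
  start : nonterminal;
  productions : seq (nonterminal * seq (nonterminal + T))
}.

Definition cfg_step (T : finType) (g : cfg T)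
    (u v : seq (nonterminal g + T)) : Prop :=
  exists l r X rhs, [/\ (X, rhs) \in productions g,
    u = l ++ inl X :: r & v = l ++ rhs ++ r].

Definition cfg_lang (T : finType) (g : cfg T) : set (seq T) :=
  [set w | clos_refl_trans _ (@cfg_step T g) [:: inl (start g)] (map inr w)].

Definition context_free_lang (T : finType) (L : set (seq T)) : Prop :=
  exists g : cfg T, cfg_lang g = L.

Section FullSubgraph.
Variables (A : finType) (G : invol_digraph A) (P : set G).

Definition full_edge : Type :=
  {e : edge G | (src e \in P) && (tgt e \in P)}.

Definition full_src (e : full_edge) : set_type P :=
  exist _ (src (sval e)) (proj1 (andP (svalP e))).

Definition full_tgt (e : full_edge) : set_type P :=
  exist _ (tgt (sval e)) (proj2 (andP (svalP e))).

Lemma full_einv_subproof (e : full_edge) :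
  (src (einv (sval e)) \in P) && (tgt (einv (sval e)) \in P).
Proof. by rewrite src_einv tgt_einv andbC (svalP e). Qed.

Definition full_einv (e : full_edge) : full_edge :=
  exist _ (einv (sval e)) (full_einv_subproof e).

Lemma full_einvK : involutive full_einv.
Proof. by move=> e; apply: val_inj; rewrite /= einvK. Qed.

Lemma full_einv_neq (e : full_edge) : e <> full_einv e.
Proof. by move=> /(congr1 sval) /=; apply: einv_neq. Qed.

Lemma full_src_einv (e : full_edge) : full_src (full_einv e) = full_tgt e.
Proof. by apply: val_inj; rewrite /= src_einv. Qed.

Lemma full_tgt_einv (e : full_edge) : full_tgt (full_einv e) = full_src e.
Proof. by apply: val_inj; rewrite /= tgt_einv. Qed.

Definition full_subgraph : invol_digraph A :=
  @InvolDigraph A (set_type P) full_edge full_src full_tgt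
    (fun e => lab (sval e)) full_einv full_einvK full_einv_neq
    full_src_einv full_tgt_einv (fun e => lab_einv (sval e)).

End FullSubgraph.

Section MullerSchupp.
Variables (A : finType) (G : inverse_graph A).

Lemma dist_subproof (x y : G) :
  exists n, `[< exists p, walk x p y /\ size p = n >].
Proof.
by have [p xpy] := connected x y; exists (size p); apply/asboolP; exists p.
Qed.

Definition dist (x y : G) : nat := ex_minn (dist_subproof x y).

Variable x0 : G.

(* The vertices of the connected component of v in the full subgraph on
   { y | dist x0 v <= dist x0 y }. *)
Definition cone_set (v : G) : set G :=
  [set y | exists p, walk v p y /\
     all (fun e => dist x0 v <= dist x0 (tgt e)) p].

Definition end_cone (v : G) : invol_digraph A := full_subgraph (cone_set v).

Definition frontier (v : G) : set (end_cone v) :=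
  [set y | dist x0 (sval y) = dist x0 v].

Definition end_isomorphic (v w : G) : Prop :=
  exists f : graph_iso (end_cone v) (end_cone w), f @` @frontier v = @frontier w.

Definition context_free_graph : Prop :=
  exists (n : nat) (r : 'I_n -> G), forall v, exists i, end_isomorphic v (r i).

End MullerSchupp.

(* Real-time deterministic pushdown automata over A ∪ A^-1; [None] encodes an
   undefined transition. *)
Record pda (A : finType) := Pda {
  state : finType;
  stack_symbol : finType;
  delta : state -> letter A -> stack_symbol -> option (state * seq stack_symbol);
  init_state : state;
  init_symbol : stack_symbol;
  final_states : {set state}
}.

Section ConfigurationsGraph.
Variables (A : finType) (M : pda A).

(* The top of the stack is the last element of the list. *)
Definition config : Type := state M * seq (stack_symbol M).

Definition step (c : config) (a : letter A) (d : config) : Prop :=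
  exists q p xi x gamma, [/\ c = (q, rcons xi x),
    delta q a x = Some (p, gamma) & d = (p, xi ++ gamma)].

Definition init_config : config := (init_state M, [:: init_symbol M]).

Definition reachable : set config :=
  [set c | clos_refl_trans _ (fun c d => exists a, step c a d) init_config c].

Definition inverse_pda : Prop :=
  forall (a : A) (c d : config), reachable c -> reachable d ->
    (step c (inl a) d <-> step d (inr a) c).

Hypothesis Minv : inverse_pda.

Definition conf_vertex : Type := set_type reachable.

Definition conf_edge : Type :=
  {e : conf_vertex * letter A * conf_vertex |
     `[< step (sval e.1.1) e.1.2 (sval e.2) >]}.

Definition conf_src (e : conf_edge) : conf_vertex := (sval e).1.1.
Definition conf_tgt (e : conf_edge) : conf_vertex := (sval e).2.
Definition conf_lab (e : conf_edge) : letter A := (sval e).1.2.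

Lemma step_inv (c d : conf_vertex) (a : letter A) :
  step (sval c) a (sval d) -> step (sval d) (letter_inv a) (sval c).
Proof.
have rc : reachable (sval c) by apply/set_mem/(svalP c).
have rd : reachable (sval d) by apply/set_mem/(svalP d).
by case: a => a /=; [move/(Minv a rc rd) | move/(Minv a rd rc)].
Qed.

Lemma conf_einv_subproof (e : conf_edge) :
  `[< step (sval (conf_tgt e)) (letter_inv (conf_lab e)) (sval (conf_src e)) >].
Proof. by apply/asboolP/step_inv/asboolP/(svalP e). Qed.

Definition conf_einv (e : conf_edge) : conf_edge :=
  exist _ (conf_tgt e, letter_inv (conf_lab e), conf_src e)
    (conf_einv_subproof e).

Lemma conf_einvK : involutive conf_einv.
Proof. by case=> [[[c a] d] s]; apply: val_inj; case: a s. Qed.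

Lemma conf_einv_neq (e : conf_edge) : e <> conf_einv e.
Proof.
by case: e => [[[c [a|a]] d] s] /(congr1 (fun e => (sval e).1.2)).
Qed.

Definition conf_digraph : invol_digraph A :=
  @InvolDigraph A conf_vertex conf_edge conf_src conf_tgt conf_lab conf_einv
    conf_einvK conf_einv_neq (fun=> erefl) (fun=> erefl) (fun=> erefl).

Lemma reachable_init : init_config \in reachable.
Proof. by apply/mem_set/rt_refl. Qed.

Definition conf_init : conf_digraph := exist _ init_config reachable_init.

Lemma conf_init_walk (c : conf_digraph) : exists p, walk conf_init p c.
Proof.
case: c => c cr; have rc := clos_rt_rtn1 _ _ _ _ (set_mem cr).
elim: rc cr => [cr|d e [a da] rd IH er].
  by exists [::]; apply: val_inj.
have dr : d \in reachable by apply/mem_set/clos_rtn1_rt.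
have [p xpd] := IH dr.
have s : `[< step d a e >] by apply/asboolP.
pose ed : conf_edge := exist _ (exist _ d dr, a, exist _ e er) s.
by exists (p ++ [:: ed]); apply: walk_cat xpd _.
Qed.

Lemma conf_connected (c d : conf_digraph) : exists p, walk c p d.
Proof.
have [p /walk_sym[p' cp]] := conf_init_walk c; have [q qd] := conf_init_walk d.
by exists (p' ++ q); apply: walk_cat cp qd.
Qed.

Lemma conf_deterministic (e f : edge conf_digraph) :
  src e = src f -> lab e = lab f -> e = f.
Proof.
case: e f => [[[c a] d] s] [[[c' a'] d'] s'].
rewrite /= /conf_src /conf_lab /= => ec ea.
apply: val_inj; subst c' a'; congr (_, _).
move: s s' => /asboolP /= + /asboolP /=.
move=> [q [p [xi [x [g [-> dl ed]]]]]] [q' [p' [xi' [x' [g' [E dl' ed']]]]]].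
case: E => Eq /rcons_inj[Ex Ey]; subst q' xi' x'.
by move: dl'; rewrite dl => -[Ep Eg]; subst p' g'; apply: val_inj; rewrite /= ed ed'.
Qed.

Definition conf_graph : inverse_graph A :=
  InverseGraph conf_connected conf_deterministic.

Definition conf_root : conf_graph := conf_init.

End ConfigurationsGraph.

(* Main.v *)
(* From a context-free language to finitely many cones: let a derivation tree
   produce u z w, where u and w are geodesic words from and to the root and z
   labels a walk inside the end-cone of v between two frontier points. A node of
   the tree whose yield overlaps both z and its complement spans a chord of
   bounded length, so z splits into pieces, each derived from a single node,
   whose endpoints stay in a ball of fixed radius around v. Hence the languages
   of walks inside the cone are determined by finitely many bits, namely which
   nodes label which pairs of points of that ball, and so is the cone, a
   deterministic graph being determined by the words readable in it.

   From finitely many cones to an automaton: the end-cones containing v form a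
   descending chain, and each of them is embedded step by step in one of the
   finitely many representatives. The stack records the position of each cone of
   the chain inside the representative of its predecessor, the state records the
   position of v in the last representative, and an edge at v only acts on the
   top of the stack.

   The languages of walks between configurations of an automaton are context-free
   by the triple construction; this does not depend on the root, whence the
   remaining implications. *)

From Stdlib Require Import Relation_Operators Operators_Properties.
Require Import Defs.
From mathcomp Require Import all_boot.
From mathcomp Require Import boolp classical_sets functions cardinality.
From mathcomp Require Import zify.

Set Implicit Arguments.
Unset Strict Implicit.
Unset Printing Implicit Defensive.

(** * Traces: walks described by their labels *)

Definition word_inv (A : finType) (w : seq (letter A)) : seq (letter A) :=
  rev (map (@letter_inv A) w).

Definition arrow (A : finType) (G : invol_digraph A) (x : G) (a : letter A)
    (y : G) : Prop :=
  exists e : edge G, [/\ src e = x, lab e = a & tgt e = y].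

(* The starting vertex is not required to satisfy [P]. *)
Fixpoint trace (A : finType) (G : invol_digraph A) (P : pred G) (x : G)
    (w : seq (letter A)) (y : G) : Prop :=
  match w with
  | [::] => x = y
  | a :: w' => exists z, [/\ arrow x a z, P z & trace P z w' y]
  end.

Section InvolDigraph.
Variables (A : finType) (G : invol_digraph A).
Implicit Types (P Q : pred G) (x y z : G) (w : seq (letter A)).

Lemma arrow_sym x a y : arrow x a y -> arrow y (letter_inv a) x.
Proof.
by move=> [e [<- <- <-]]; exists (einv e); rewrite src_einv lab_einv tgt_einv.
Qed.

Lemma trace_catP P x w1 w2 z :
  trace P x (w1 ++ w2) z <-> exists2 y, trace P x w1 y & trace P y w2 z.
Proof.
elim: w1 x => [|a w IH] x /=; first by split=> [|[y <-]//]; exists x.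
split=> [[y [xy Py /IH[t yt tz]]]|[t [y [xy Py yt tz]]]].
  by exists t => //; exists y.
by exists y; split=> //; apply/IH; exists t.
Qed.

Lemma trace_rconsP P x w a y :
  trace P x (rcons w a) y <-> exists z, [/\ trace P x w z, arrow z a y & P y].
Proof.
rewrite -cats1 trace_catP; split=> [[z xz [t [zt Pt <-]]]|[z [xz zy Py]]].
  by exists z.
by exists z => //; exists y.
Qed.

Lemma trace_sub P Q x w y : subpred P Q -> trace P x w y -> trace Q x w y.
Proof.
move=> PQ; elim: w x => //= a w IH x [z [xz Pz zy]].
by exists z; split=> //; [apply: PQ | apply: IH].
Qed.

Lemma trace_predT P x w y : trace P x w y -> trace predT x w y.
Proof. exact: trace_sub. Qed.

Lemma trace_last P x w y : P x -> trace P x w y -> P y.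
Proof. by elim: w x => [|a w IH] x Px /= => [<-//|[z [_ Pz]]]; apply: IH. Qed.

Lemma trace_sym P x w y : P x -> trace P x w y -> trace P y (word_inv w) x.
Proof.
rewrite /word_inv; elim: w x => [|a w IH] x Px //= [z [xz Pz zy]].
rewrite rev_cons; apply/trace_rconsP; exists z; split=> //; first exact: IH.
exact: arrow_sym.
Qed.

Lemma trace_walk P x w y :
  trace P x w y <->
  exists p, [/\ walk x p y, all (fun e => P (tgt e)) p & w = map (@lab A G) p].
Proof.
elim: w x => [|a w IH] x /=.
  by split=> [->|[[|e p] [xy _ //]]]; first exists [::].
split=> [[z [[e [<- <- <-]] Pz /IH[p [yp allp ->]]]]|].
  by exists (e :: p); split=> //=; rewrite Pz.
case=> -[|e p] [//= [<- yp] /andP[Pe allp] [-> wE]].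
by exists (tgt e); split=> //; [exists e | apply/IH; exists p].
Qed.

End InvolDigraph.

Lemma walk_langE (A : finType) (G : invol_digraph A) (x : G) (F : set G) w :
  walk_lang x F w <-> exists2 y, F y & trace predT x w y.
Proof.
split=> [[y [p [Fy xy ->]]]|[y Fy /trace_walk[p [xy _ ->]]]]; last by exists y, p.
by exists y => //; apply/trace_walk; exists p; split=> //; apply: all_predT.
Qed.

Section InverseGraph.
Variables (A : finType) (G : inverse_graph A).
Implicit Types (P Q : pred G) (x y z : G) (w : seq (letter A)).

Lemma arrow_det x a y z : arrow x a y -> arrow x a z -> y = z.
Proof.
by move=> [e [<- <- <-]] [f [fe /esym lf <-]]; rewrite (deterministic (esym fe) lf).
Qed.

Lemma arrow_codet x y a z : arrow x a z -> arrow y a z -> x = y.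
Proof. by move=> /arrow_sym + /arrow_sym; apply: arrow_det. Qed.

Lemma trace_det P Q x w y z : trace P x w y -> trace Q x w z -> y = z.
Proof.
elim: w x => [|a w IH] x /= => [<-//|[t [xt _ ty]] [t' [xt' _]]].
by rewrite (arrow_det xt' xt); apply: IH.
Qed.

Lemma trace_codet P Q x y w z : trace P x w z -> trace Q y w z -> x = y.
Proof.
elim: w x y => [|a w IH] x y /= => [-> -> //|[t [xt _ tz]] [t' [xt' _ tz']]].
by rewrite -(IH _ _ tz tz') in xt'; apply: arrow_codet xt xt'.
Qed.

(** * Distance from the root and connectedness above a level *)

Section Levels.
Variable x0 : G.
Notation lvl := (dist x0).

Lemma dist_trace y : exists2 w, trace predT x0 w y & size w = lvl y.
Proof.
rewrite /dist; case: ex_minnP => n /asboolP[p [xp <-]] _.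
exists (map (@lab A G) p); last by rewrite size_map.
by apply/trace_walk; exists p; split=> //; apply: all_predT.
Qed.

Lemma dist_le w y : trace predT x0 w y -> lvl y <= size w.
Proof.
move=> /trace_walk[p [xp _ ->]]; rewrite size_map /dist.
by case: ex_minnP => n _; apply; apply/asboolP; exists p.
Qed.

Lemma dist0 : lvl x0 = 0.
Proof. by apply/eqP; rewrite -leqn0; exact: (@dist_le [::]). Qed.

Lemma dist_eq0 y : lvl y = 0 -> y = x0.
Proof.
by move=> y0; have [w xy] := dist_trace y; rewrite y0 => /size0nil w0; rewrite w0 in xy.
Qed.

Lemma dist_trace_le P x w y : trace P x w y -> lvl y <= lvl x + size w.
Proof.
move=> /trace_predT xy; have [u ux <-] := dist_trace x.
by rewrite -size_cat; apply: dist_le; apply/trace_catP; exists x.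
Qed.

Lemma dist_trace_ge P x w y : trace P x w y -> lvl x <= lvl y + size w.
Proof.
move=> /trace_predT/(trace_sym isT)/dist_trace_le.
by rewrite size_rev size_map.
Qed.

Lemma arrow_dist x a y : arrow x a y -> lvl y <= (lvl x).+1.
Proof.
move=> xy; have := @dist_trace_le predT x [:: a] y.
by rewrite addn1; apply; exists y.
Qed.

Lemma dist_pred n y : lvl y = n.+1 -> exists x a, arrow x a y /\ lvl x = n.
Proof.
move=> yn; have [w] := dist_trace y; rewrite yn.
elim/last_ind: w => // w a _; rewrite size_rcons => /trace_rconsP[x [xw xy _]] [wn].
exists x, a; split=> //.
by have := dist_le xw; have := arrow_dist xy; rewrite yn wn; lia.
Qed.

Definition above n : pred G := fun y => n <= lvl y.

Definition linked n x y : Prop := exists w, trace (above n) x w y.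

Lemma linked_refl n x : linked n x x.
Proof. by exists [::]. Qed.

Lemma linked_trans n x y z : linked n x y -> linked n y z -> linked n x z.
Proof. by move=> [u xy] [w yz]; exists (u ++ w); apply/trace_catP; exists y. Qed.

Lemma linked_sym n x y : n <= lvl x -> linked n x y -> linked n y x.
Proof. by move=> nx [w xy]; exists (word_inv w); apply: trace_sym. Qed.

Lemma linked_mono m n x y : m <= n -> linked n x y -> linked m x y.
Proof.
by move=> mn [w xy]; exists w; apply: trace_sub xy => z; apply: leq_trans.
Qed.

Lemma linked_above n x y : n <= lvl x -> linked n x y -> n <= lvl y.
Proof. by move=> nx [w]; apply: (@trace_last _ _ (above n)). Qed.

Lemma linked_arrow n x a y : arrow x a y -> n <= lvl y -> linked n x y.
Proof. by move=> xy ny; exists [:: a], y. Qed.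

Lemma cone_setE v y : cone_set x0 v y <-> linked (lvl v) v y.
Proof.
split=> [[p [vp ap]]|[w /trace_walk[p [vp ap _]]]]; last by exists p.
by exists (map (@lab A G) p); apply/trace_walk; exists p.
Qed.

Lemma linked_parent n y : n <= lvl y -> exists2 x, lvl x = n & linked n x y.
Proof.
have [k] := ubnP (lvl y - n); elim: k y => // k IH y; rewrite ltnS => ky ny.
have [yn|yn] := eqVneq (lvl y) n; first by exists y => //; apply: linked_refl.
have [z [a [zy lz]]] : exists z a, arrow z a y /\ lvl z = (lvl y).-1.
  by apply: dist_pred; lia.
have [||x xn xz] := IH z; [lia | lia|].
by exists x => //; apply: linked_trans xz (linked_arrow zy ny).
Qed.

End Levels.
End InverseGraph.

Lemma inj_surj_bij (T U : Type) (f : T -> U) :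
  injective f -> (forall y, exists x, f x = y) -> bijective f.
Proof.
move=> finj /choice[g fg]; exists g => // x; exact/finj/fg.
Qed.

Definition digraph_det (A : finType) (G : invol_digraph A) : Prop :=
  forall e f : edge G, src e = src f -> lab e = lab f -> e = f.

(** In a deterministic digraph an edge is determined by its source and label, so a vertex bijection
    preserving and reflecting arrows extends to edges. *)
Lemma graph_iso_of_arrow (A : finType) (G H : invol_digraph A) (f : G -> H) :
  digraph_det G -> digraph_det H -> bijective f ->
  (forall x a y, arrow x a y <-> arrow (f x) a (f y)) ->
  exists F : graph_iso G H, iso_vertex F = f.
Proof.
move=> detG detH fbij fE; have finj := bij_inj fbij.
have /choice[fe feP] : forall e : edge G, exists e' : edge H,
    [/\ src e' = f (src e), lab e' = lab e & tgt e' = f (tgt e)].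
  move=> e; have [|e' [? ? ?]] := (fE (src e) (lab e) (tgt e)).1.
    by exists e.
  by exists e'.
have fes e : src (fe e) = f (src e) by have [] := feP e.
have fel e : lab (fe e) = lab e by have [] := feP e.
have fet e : tgt (fe e) = f (tgt e) by have [] := feP e.
have fei e : fe (einv e) = einv (fe e).
  by apply: detH; rewrite ?fes ?fel ?src_einv ?lab_einv ?fet ?fel.
have febij : bijective fe.
  apply: inj_surj_bij => [e e' ee'|e].
    apply: detG; last by rewrite -!fel ee'.
    by apply: finj; rewrite -!fes ee'.
  have [g _ gK] := fbij.
  have [|e' [s l t]] := (fE (g (src e)) (lab e) (g (tgt e))).2.
    by rewrite !gK; exists e.
  by exists e'; apply: detH; rewrite ?fes ?fel ?s ?l ?gK.
by exists (GraphIso fes fet fel fei fbij febij).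
Qed.

(** * End-cones *)

Lemma full_vertex_inj (A : finType) (G : invol_digraph A) (P : set G)
    (x y : full_subgraph P) :
  sval x = sval y -> x = y.
Proof. by case: x y => [x xP] [y yP]; apply: val_inj. Qed.

Lemma full_arrow (A : finType) (G : invol_digraph A) (P : set G)
    (x y : full_subgraph P) a :
  arrow x a y <-> arrow (sval x) a (sval y).
Proof.
split=> [[e [<- <- <-]]|[e [ex <- ey]]]; first by exists (sval e).
have exy : (src e \in P) && (tgt e \in P) by rewrite ex ey (svalP x) (svalP y).
by exists (exist _ e exy); split=> //; apply: val_inj.
Qed.

Lemma full_det (A : finType) (G : inverse_graph A) (P : set G) :
  digraph_det (full_subgraph P).
Proof.
by move=> e f /(congr1 sval) /= sef lef; apply/val_inj/deterministic.
Qed.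

Lemma iso_arrow (A : finType) (G H : invol_digraph A) (F : graph_iso G H) x a y :
  arrow x a y <-> arrow (F x) a (F y).
Proof.
split=> [[e [<- <- <-]]|[e [ex <- ey]]].
  by exists (iso_edge F e); rewrite iso_src iso_lab iso_tgt.
have [g _ gK] := iso_edge_bij F; have Finj := bij_inj (iso_vertex_bij F).
exists (g e); rewrite -(iso_lab F) gK; split=> //; apply: Finj.
  by rewrite -iso_src gK.
by rewrite -iso_tgt gK.
Qed.

(** * End-isomorphisms as maps between vertices *)

Section EndMaps.
Variables (A : finType) (G : inverse_graph A) (x0 : G).
Notation lvl := (dist x0).

Definition cone v y := linked x0 (lvl v) v y.

Lemma cone_refl v : cone v v.
Proof. exact: linked_refl. Qed.

Lemma cone_dist v y : cone v y -> lvl v <= lvl y.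
Proof. exact: linked_above. Qed.

Lemma cone_linked v y z : cone v y -> linked x0 (lvl v) y z -> cone v z.
Proof. exact: linked_trans. Qed.

Lemma cone_arrow v y a z : cone v y -> arrow y a z -> lvl v <= lvl z -> cone v z.
Proof. by move=> vy yz vz; apply: cone_linked vy (linked_arrow yz vz). Qed.

Lemma cone_sub v w y : cone v w -> cone w y -> cone v y.
Proof.
by move=> vw wy; apply: cone_linked vw (linked_mono (cone_dist vw) wy).
Qed.

(** An equivalence relation: related vertices are frontier points of one and the same end-cone, so
    its classes stand for the cones. *)
Definition coned v w := lvl w = lvl v /\ cone v w.

Lemma coned_refl v : coned v v.
Proof. by split=> //; apply: cone_refl. Qed.

Lemma coned_sym v w : coned v w -> coned w v.
Proof. by move=> [e vw]; split=> //; rewrite /cone e; apply: linked_sym. Qed.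

Lemma coned_cone v w y : coned v w -> cone v y <-> cone w y.
Proof.
by move=> vw; have [_ wv] := coned_sym vw; case: vw => _ vw; split; apply: cone_sub.
Qed.

Lemma coned_trans v w z : coned v w -> coned w z -> coned v z.
Proof.
move=> vw [zw wz]; split; first by case: vw => <-.
exact/(coned_cone z vw).
Qed.

Lemma coned_parent u v y : lvl u = lvl v -> cone u y -> cone v y -> coned u v.
Proof.
move=> uv uy; rewrite /cone -uv => vy; split=> //.
by apply: cone_linked uy (linked_sym _ vy); rewrite uv.
Qed.

(** An end-isomorphism as a total function constrained only on the cone of [v]. This avoids
    subtypes, and one function can be reused on smaller cones. *)
Record end_map (v w : G) (f : G -> G) : Prop := EndMap {
  end_map_cone : forall y, cone v y -> cone w (f y);
  end_map_frontier : forall y, cone v y -> lvl y = lvl v <-> lvl (f y) = lvl w;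
  end_map_inj : forall y z, cone v y -> cone v z -> f y = f z -> y = z;
  end_map_surj : forall y, cone w y -> exists2 z, cone v z & f z = y;
  end_map_arrow : forall y a z, cone v y -> cone v z ->
    arrow y a z <-> arrow (f y) a (f z)
}.

Lemma in_coneP v y : reflect (cone v y) (y \in cone_set x0 v).
Proof.
by apply: (iffP idP) => [/set_mem/cone_setE //|/cone_setE/mem_set].
Qed.

Lemma end_isomorphicP v w : end_isomorphic x0 v w <-> exists f, end_map v w f.
Proof.
split=> [[F FE]|[f fE]].
  have /choice[f fP] : forall y, exists z, forall p : y \in cone_set x0 v,
      sval (F (exist _ y p)) = z.
    move=> y; have [p|np] := pselect (y \in cone_set x0 v).
      by exists (sval (F (exist _ y p))) => p'; rewrite (bool_irrelevance p p').
    by exists y.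
  have Finj := bij_inj (iso_vertex_bij F).
  exists f; split.
  - by move=> y /in_coneP p; rewrite -(fP y p); apply/in_coneP; exact: (svalP (F _)).
  - move=> y /in_coneP p; rewrite -(fP y p); split=> yl.
      have : (F @` @frontier _ _ x0 v)%classic (F (exist _ y p)) by exists (exist _ y p).
      by rewrite FE.
    have : @frontier _ _ x0 w (F (exist _ y p)) by [].
    by rewrite -FE => -[z zv /Finj zy]; rewrite zy in zv.
  - move=> y z /in_coneP p /in_coneP p'; rewrite -(fP y p) -(fP z p').
    by move=> /val_inj/Finj[].
  - move=> y /in_coneP p; have [g _ gK] := iso_vertex_bij F.
    case E : (g (exist _ y p)) => [z q].
    by exists z; [apply/in_coneP | rewrite -(fP z q) -E gK].
  - move=> y a z /in_coneP p /in_coneP p'; rewrite -(fP y p) -(fP z p').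
    by rewrite -full_arrow -(iso_arrow F) full_arrow.
pose h (y : end_cone x0 v) : end_cone x0 w :=
  exist _ (f (sval y))
    (introT (in_coneP w _) (end_map_cone fE (elimT (in_coneP v _) (svalP y)))).
have coneh (y : end_cone x0 v) : cone v (sval y) by apply/in_coneP; exact: (svalP y).
have hbij : bijective h.
  apply: inj_surj_bij => [y z /(congr1 sval) /= e|[y p]].
    exact/full_vertex_inj/(end_map_inj fE).
  have [|z /in_coneP q zy] := end_map_surj fE (y := y); first exact/in_coneP.
  by exists (exist _ z q); apply: full_vertex_inj.
have [|F FE] := graph_iso_of_arrow (@full_det _ _ _) (@full_det _ _ _) hbij.
  move=> y a z; rewrite !full_arrow /=; exact: (end_map_arrow fE).
exists F; rewrite FE; apply/seteqP; split=> [_ [y yv <-]|y yw]; last first.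
  have [g _ gK] := hbij; exists (g y); last exact: gK.
  by apply/(end_map_frontier fE (coneh _)); rewrite -[f _]/(sval (h (g y))) gK.
exact/(end_map_frontier fE (coneh y)).
Qed.

Section EndMapTheory.
Variables (v w : G) (f : G -> G).
Hypothesis fE : end_map v w f.

(** A vertex of the cone above the frontier has a neighbour in the cone one level lower. Climbing
    from the frontier, [f] cannot raise relative levels, and neither can its inverse. *)
Lemma end_map_dist y : cone v y -> lvl (f y) + lvl v = lvl y + lvl w.
Proof.
move=> vy; have wf := cone_dist (end_map_cone fE vy); have vy' := cone_dist vy.
have le1 k z : cone v z -> lvl z <= lvl v + k -> lvl (f z) <= lvl w + k.
  elim: k z => [|k IH] z vz zk.
    by have := (end_map_frontier fE vz).1; have := cone_dist vz; lia.
  have [/(IH z vz)|zk'] := leqP (lvl z) (lvl v + k); first by lia.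
  have [t [a [tz tk]]] : exists t a, arrow t a z /\ lvl t = lvl v + k.
    by apply: dist_pred; lia.
  have vt : cone v t by apply: cone_arrow vz (arrow_sym tz) _; lia.
  have := IH t vt; have := arrow_dist x0 ((end_map_arrow fE a vt vz).1 tz); lia.
have le2 k z : cone v z -> lvl (f z) <= lvl w + k -> lvl z <= lvl v + k.
  elim: k z => [|k IH] z vz zk; have wz := end_map_cone fE vz.
    by have := (end_map_frontier fE vz).2; have := cone_dist wz; lia.
  have [/(IH z vz)|zk'] := leqP (lvl (f z)) (lvl w + k); first by lia.
  have [t' [a [tz tk]]] : exists t a, arrow t a (f z) /\ lvl t = lvl w + k.
    by apply: dist_pred; lia.
  have wt : cone w t' by apply: cone_arrow wz (arrow_sym tz) _; lia.
  have [t vt ft] := end_map_surj fE wt; rewrite -ft in tz tk.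
  have := IH t vt; have := arrow_dist x0 ((end_map_arrow fE a vt vz).2 tz); lia.
have := le1 (lvl y - lvl v) y vy; have := le2 (lvl (f y) - lvl w) y vy; lia.
Qed.

(** Since [f] shifts levels by a constant, walks not descending below the level of [x] correspond to
    walks not descending below that of [f x]. *)
Lemma end_map_restrict x : cone v x -> end_map x (f x) f.
Proof.
move=> vx; have fx := end_map_dist vx.
have sub y : cone x y -> cone v y by apply: cone_sub.
split=> [y [u]||y z /sub vy /sub vz|y [u]|y a z yc zc].
- suff run z : cone x z -> cone (f x) (f z) -> trace (above x0 (lvl x)) z u y ->
      cone (f x) (f y) by apply: run; apply: cone_refl.
  elim: u z => [|a u IH] z xz fz /=; first by move=> <-.
  move=> [t [zt xt]]; have ct : cone x t by apply: cone_arrow xz zt xt.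
  apply: IH => //; apply: cone_arrow fz ((end_map_arrow fE _ _ _).1 zt) _.
  + exact: sub.
  + exact: sub.
  + by have := end_map_dist (sub _ ct); move: xt; rewrite /above; lia.
- by move=> y xy; have := end_map_dist (sub _ xy); lia.
- exact: (end_map_inj fE).
- suff run z : cone x z -> trace (above x0 (lvl (f x))) (f z) u y ->
      exists2 z, cone x z & f z = y by apply: run; apply: cone_refl.
  elim: u z => [|a u IH] z xz /=; first by exists z.
  move=> [t [zt xt ty]].
  have wt : cone w t.
    apply: cone_arrow (end_map_cone fE (sub _ xz)) zt _.
    by move: xt (cone_dist (end_map_cone fE vx)); rewrite /above; lia.
  have [t' vt E] := end_map_surj fE wt; move: zt xt ty; rewrite -E => zt xt.
  apply: IH; apply: cone_arrow xz ((end_map_arrow fE _ (sub _ xz) vt).2 zt) _.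
  by have := end_map_dist vt; move: xt; rewrite /above; lia.
- by apply: (end_map_arrow fE); apply: sub.
Qed.

Lemma end_map_coned v' w' : coned v v' -> coned w w' -> end_map v' w' f.
Proof.
move=> cv cw; split=> [y|y|y z|y|y a z]; rewrite -?(coned_cone _ cv) -?(coned_cone _ cw).
- exact: (end_map_cone fE).
- by move=> vy; have [-> _] := cv; have [-> _] := cw; apply: (end_map_frontier fE).
- exact: (end_map_inj fE).
- by move=> /(end_map_surj fE)[z vz zy]; exists z => //; apply/(coned_cone _ cv).
- exact: (end_map_arrow fE).
Qed.

Lemma end_map_root : coned w (f v).
Proof.
split; last exact/(end_map_cone fE)/cone_refl.
by apply/(end_map_frontier fE); first exact: cone_refl.
Qed.

End EndMapTheory.

Lemma end_map_comp u v w f g :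
  end_map u v f -> end_map v w g -> end_map u w (g \o f).
Proof.
move=> fE gE; have fc y := @end_map_cone _ _ _ fE y.
split=> /= [y /fc|y cy|y z cy cz|y|y a z cy cz].
- exact: (end_map_cone gE).
- by rewrite (end_map_frontier fE cy) (end_map_frontier gE (fc _ cy)).
- by move=> /(end_map_inj gE (fc _ cy) (fc _ cz)); apply: (end_map_inj fE).
- move=> /(end_map_surj gE)[z /(end_map_surj fE)[t ut <-] <-]; by exists t.
- by rewrite (end_map_arrow fE _ cy cz) (end_map_arrow gE _ (fc _ cy) (fc _ cz)).
Qed.

End EndMaps.

(** * Pushdown automata and codings of graphs by their configurations *)

(** The image contains the initial configuration and is closed under steps, hence is the set of
    reachable configurations: a coding amounts to a rooted isomorphism with the configurations
    graph. *)
Definition coding (A : finType) (G : inverse_graph A) (x0 : G) (M : pda A)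
    (code : G -> config M) : Prop :=
  [/\ injective code, code x0 = init_config M &
      forall v a d, step (code v) a d <-> exists2 w, arrow v a w & d = code w].

Lemma conf_arrow (A : finType) (M : pda A) (Minv : inverse_pda M)
    (c d : conf_graph Minv) a :
  arrow c a d <-> step (sval c) a (sval d).
Proof.
split=> [[[[[x b] y] s] [/= <- <- <-]]|/asboolP s]; first exact/asboolP.
by exists (exist _ (c, a, d) s).
Qed.

Section Coding.
Variables (A : finType) (G : inverse_graph A) (x0 : G).

Lemma coding_of_iso (M : pda A) (Minv : inverse_pda M) :
  rooted_isomorphic (conf_root Minv) x0 -> exists code, @coding A G x0 M code.
Proof.
move=> [F Fx0]; have [g Fg gF] := iso_vertex_bij F.
have Farrow c a v : arrow c a (g v) <-> arrow (F c) a v.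
  by rewrite (iso_arrow F) gF.
exists (fun v => sval (g v)); split.
- by move=> v w /val_inj/(can_inj gF).
- by rewrite -Fx0 Fg.
- move=> v a d; split=> [s|[w vw ->]]; last by apply/conf_arrow/Farrow; rewrite gF.
  have dr : d \in @reachable _ M.
    apply/mem_set; apply: rt_trans (set_mem (svalP (g v))) _.
    by apply: rt_step; exists a.
  exists (F (exist _ d dr)); last by rewrite Fg.
  by rewrite -(gF v) -(iso_arrow F); apply/conf_arrow.
Qed.

Variables (M : pda A) (code : G -> config M).
Hypothesis codeP : coding x0 code.

Let code_inj : injective code. Proof. by case: codeP. Qed.
Let code_root : code x0 = init_config M. Proof. by case: codeP. Qed.
Let code_step v a d : step (code v) a d <-> exists2 w, arrow v a w & d = code w.
Proof. by case: codeP. Qed.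

Lemma coding_arrow v a w : step (code v) a (code w) <-> arrow v a w.
Proof.
by rewrite code_step; split=> [[t vt /code_inj ->] //|vw]; exists w.
Qed.

Lemma coding_reachable c : reachable c <-> exists v, c = code v.
Proof.
split=> [cr|[v ->]].
  have rc := clos_rt_rtn1 _ _ _ _ cr.
  elim: rc => [|d e [a s] _ [v E]]; first by exists x0.
  by move: s; rewrite E => /code_step[w _ ->]; exists w.
have [w xv _] := dist_trace x0 v; rewrite /reachable /= -code_root.
elim: w (x0) xv => [|a w IH] x /=; first by move=> <-; apply: rt_refl.
move=> [z [xz _ /IH zv]]; apply: rt_trans zv; apply: rt_step.
by exists a; apply/coding_arrow.
Qed.

Lemma coding_inverse : inverse_pda M.
Proof.
move=> a c d /coding_reachable[v ->] /coding_reachable[w ->].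
by rewrite !coding_arrow; split=> /arrow_sym.
Qed.

Lemma iso_of_coding : rooted_isomorphic (conf_root coding_inverse) x0.
Proof.
have /choice[f fE] (c : conf_graph coding_inverse) : exists v, sval c = code v.
  exact/coding_reachable/set_mem/(svalP c).
have fbij : bijective f.
  apply: inj_surj_bij => [c d E|v]; first by apply: val_inj; rewrite [LHS]fE E -fE.
  have vr : code v \in @reachable _ M by apply/mem_set/coding_reachable; exists v.
  by exists (exist _ (code v) vr : conf_vertex M); apply: code_inj; rewrite -fE.
have [||c a d|F FE] := graph_iso_of_arrow _ _ fbij.
- exact: deterministic.
- exact: deterministic.
- by rewrite conf_arrow !fE coding_arrow.
by exists F; rewrite FE; apply: code_inj; rewrite -fE code_root.
Qed.

End Coding.

(* The transition function of the automaton is read off the edges of the graph,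
   so all that is needed is that an edge acts on the top symbol only. *)
Lemma local_coding (A : finType) (G : inverse_graph A) (x0 : G) (Q S : finType)
    (q0 : Q) (s0 : S) (code : G -> Q * seq S) :
  injective code -> code x0 = (q0, [:: s0]) -> (forall v, (code v).2 != [::]) ->
  (forall v v' a w' q s xi xi',
    code v = (q, rcons xi s) -> code v' = (q, rcons xi' s) -> arrow v' a w' ->
    exists w p gamma, [/\ arrow v a w, code w = (p, xi ++ gamma) &
      code w' = (p, xi' ++ gamma)]) ->
  exists (M : pda A) (c : G -> config M), coding x0 c.
Proof.
move=> code_inj code0 code_nil local.
pose R (q : Q) (a : letter A) (s : S) (o : Q * seq S) :=
  exists v w xi, [/\ arrow v a w, code v = (q, rcons xi s) &
    code w = (o.1, xi ++ o.2)].
have /choice[d dP] (qas : Q * letter A * S) : exists o : option (Q * seq S),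
    match o with
    | Some o => R qas.1.1 qas.1.2 qas.2 o
    | None => forall o, ~ R qas.1.1 qas.1.2 qas.2 o
    end.
  have [[o oP]|no] := pselect (exists o, R qas.1.1 qas.1.2 qas.2 o).
    by exists (Some o).
  by exists None => o oP; apply: no; exists o.
exists (@Pda A Q S (fun q a s => d (q, a, s)) q0 s0 finset.set0), code.
split=> // v a c; split.
  move=> [q [p [xi [s [gamma [Ev /= dE ->]]]]]]; have := dP (q, a, s); rewrite dE.
  move=> [v' [w' [xi' [/= vw' Ev' Ew']]]].
  have [w [p' [gamma' [vw Ew]]]] := local _ _ _ _ _ _ _ _ Ev Ev' vw'.
  rewrite Ew' => -[Ep /eqP]; rewrite eqseq_cat // eqxx => /eqP Eg.
  by exists w; rewrite // Ew Ep Eg.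
move=> [w vw ->]; case Ev : (code v) (code_nil v) => [q eta].
case/lastP: eta Ev => // xi s Ev _.
have [w' [p [gamma [_ _ Ew]]]] := local _ _ _ _ _ _ _ _ Ev Ev vw.
have := dP (q, a, s); case dE : (d (q, a, s)) => [[p' gamma']|] /=; last first.
  by move=> /(_ (p, gamma))[]; exists v, w, xi.
move=> [v' [w'' [xi' [/= vw' Ev' Ew']]]].
have [t [p'' [gamma'' [vt Et]]]] := local _ _ _ _ _ _ _ _ Ev Ev' vw'.
rewrite Ew' => -[Ep /eqP]; rewrite eqseq_cat // eqxx => /eqP Eg.
exists q, p', xi, s, gamma'; split=> //.
by rewrite (arrow_det vw vt) Et Ep Eg.
Qed.

(** * From finitely many end-cones to an automaton *)

Section ConeCoding.
Variables (A : finType) (G : inverse_graph A) (x0 : G).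
Variables (n : nat) (r : 'I_n -> G).
Hypothesis rP : forall v, exists i, end_isomorphic x0 v (r i).
Notation lvl := (dist x0).

(** A canonical frontier point, so that data chosen from it depend on the cone only. The set of
    candidates is non-empty because it contains [v]. *)
Definition cone_rep (v : G) : G := xget (x0 : {classic G}) (coned x0 v).

Lemma cone_repP v : coned x0 v (cone_rep v).
Proof. by apply: (@xgetPex {classic G}); exists v; apply: coned_refl. Qed.

Lemma cone_rep_eq v w : coned x0 v w -> cone_rep v = cone_rep w.
Proof.
move=> vw; rewrite /cone_rep; suff -> : coned x0 v = coned x0 w by [].
apply/seteqP; split=> z; apply: coned_trans => //; exact: coned_sym.
Qed.

Lemma cone_rep_inj v w : cone_rep v = cone_rep w -> coned x0 v w.
Proof.
move=> vw; apply: coned_trans (cone_repP v) _; rewrite vw.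
exact: coned_sym (cone_repP w).
Qed.

Lemma type_map_subproof v : exists tau i, end_map x0 v (r i) tau.
Proof. by have [i /end_isomorphicP[f fE]] := rP v; exists f, i. Qed.

Definition type_map v := projT1 (cid (type_map_subproof (cone_rep v))).

Lemma type_mapP v : exists i, end_map x0 v (r i) (type_map v).
Proof.
have [i ri] := projT2 (cid (type_map_subproof (cone_rep v))); exists i.
exact: (end_map_coned ri (coned_sym (cone_repP v)) (coned_refl _ _)).
Qed.

Lemma type_map_eq v w : coned x0 v w -> type_map v = type_map w.
Proof. by rewrite /type_map => /cone_rep_eq ->. Qed.

Lemma parent_subproof v : exists u, lvl u = (lvl v).-1 /\ cone x0 u v.
Proof.
have [u uv uv'] := @linked_parent _ _ x0 (lvl v).-1 v (leq_pred _).
by exists u; rewrite /cone uv.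
Qed.

(** A vertex one level below [v] with [v] in its cone, not necessarily a neighbour of [v]. At the
    root the truncated predecessor gives the root again. *)
Definition parent v := projT1 (cid (parent_subproof v)).

Lemma parent_dist v : lvl (parent v) = (lvl v).-1.
Proof. by case: (projT2 (cid (parent_subproof v))). Qed.

Lemma parent_cone v : cone x0 (parent v) v.
Proof. by case: (projT2 (cid (parent_subproof v))). Qed.

(** The chart sends [v] itself to the level of some [r i], and the vertices one level above [v] in
    its cone one level further. The ball of this radius contains both. *)
Definition radius := (\max_i lvl (r i)).+1.

Lemma name_subproof y : exists w, trace predT x0 w y /\ size w = lvl y.
Proof. by have [w ? ?] := dist_trace x0 y; exists w. Qed.

(** A geodesic word determines its endpoint by determinism. All vertices named below have level at
    most [radius], where [insub_bseq] keeps the word. *)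
Definition name y : radius.-bseq (letter A) :=
  insub_bseq radius (projT1 (cid (name_subproof y))).

Lemma name_inj y z : lvl y <= radius -> lvl z <= radius -> name y = name z -> y = z.
Proof.
rewrite /name; case: cid => u /= [yu <-]; case: cid => w /= [zw <-] ur wr.
move=> /(congr1 val); rewrite /insub_bseq !val_insubd ur wr => uw.
by rewrite -uw in zw; apply: trace_det yu zw.
Qed.

Definition symbol : finType := option (radius.-bseq (letter A)).

(* [(chart k v).1] embeds the cone of a vertex [v] at distance [k] into one of the
   representative cones; [(chart k v).2] is the stack, recording for each cone of
   the chain from the root to [v] its position in the chart of its predecessor. *)
Fixpoint chart (k : nat) (v : G) : (G -> G) * seq symbol :=
  match k with
  | 0 => (type_map v, [:: None])
  | k'.+1 =>
    let: (f, xi) := chart k' (parent v) in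
    (type_map (f v) \o f, rcons xi (Some (name (cone_rep (f v)))))
  end.

Definition emb v := (chart (lvl v) v).1.
Definition stack v := (chart (lvl v) v).2.

Lemma embS v : 0 < lvl v ->
  emb v = type_map (emb (parent v) v) \o emb (parent v).
Proof.
rewrite /emb parent_dist; case E : (lvl v) => [|k] //= _.
by case: (chart k _).
Qed.

Lemma stackS v : 0 < lvl v ->
  stack v = rcons (stack (parent v)) (Some (name (cone_rep (emb (parent v) v)))).
Proof.
rewrite /stack /emb parent_dist; case E : (lvl v) => [|k] //= _.
by case: (chart k _).
Qed.

Lemma embP v : exists i, end_map x0 v (r i) (emb v).
Proof.
move E : (lvl v) => k; elim: k v E => [|k IH] v E.
  by rewrite /emb E /=; apply: type_mapP.
have [|i ui] := IH (parent v); first by rewrite parent_dist E.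
rewrite (@embS v) ?E //; have [j vj] := type_mapP (emb (parent v) v); exists j.
exact: (end_map_comp (end_map_restrict ui (parent_cone v)) vj).
Qed.

Lemma emb_map v : end_map x0 v (emb v v) (emb v).
Proof. by have [i vi] := embP v; exact: (end_map_restrict vi (cone_refl _ _)). Qed.

Lemma coned_parents v w : 0 < lvl v -> coned x0 v w ->
  coned x0 (parent v) (parent w).
Proof.
move=> v0 [wv vw]; apply: (coned_parent (y := w)).
- by rewrite !parent_dist wv.
- exact: cone_sub (parent_cone v) vw.
- exact: parent_cone.
Qed.

(** By induction along the chain: frontier points of one cone have parents on one frontier, and the
    next map and symbol are chosen per cone. *)
Lemma chart_coned v w : coned x0 v w -> emb v = emb w /\ stack v = stack w.
Proof.
move E : (lvl v) => k; elim: k v w E => [|k IH] v w E vw.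
  have [wv _] := vw; rewrite /emb /stack wv E /=.
  by rewrite (type_map_eq vw).
have v0 : 0 < lvl v by rewrite E.
have [|ue us] := IH _ _ _ (coned_parents v0 vw); first by rewrite parent_dist E.
have [wv vw'] := vw; have w0 : 0 < lvl w by rewrite wv.
rewrite (embS v0) (embS w0) (stackS v0) (stackS w0) -ue -us.
suff c : coned x0 (emb (parent v) v) (emb (parent v) w).
  by rewrite (type_map_eq c) (cone_rep_eq c).
have fE := emb_map (parent v); have pv := parent_cone v.
have pw := cone_sub pv vw'; have fv := end_map_restrict fE pv.
split; last exact: (end_map_cone fv).
by apply/(end_map_frontier fv).
Qed.

Lemma emb_bound v : lvl (emb v v) < radius.
Proof.
have [i /end_map_root[-> _]] := embP v.
by rewrite ltnS (leq_bigmax (F := fun i => lvl (r i))).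
Qed.

Lemma emb_child u v : cone x0 u v -> lvl v = (lvl u).+1 ->
  lvl (emb u v) = (lvl (emb u u)).+1.
Proof. by move=> uv E; have := end_map_dist (emb_map u) uv; rewrite E; lia. Qed.

Lemma name_child_inj u u' v v' :
  cone x0 u v -> lvl v = (lvl u).+1 -> cone x0 u' v' -> lvl v' = (lvl u').+1 ->
  name (cone_rep (emb u v)) = name (cone_rep (emb u' v')) ->
  coned x0 (emb u v) (emb u' v').
Proof.
move=> uv vu uv' vu' /name_inj E; apply: cone_rep_inj; apply: E.
  have [-> _] := cone_repP (emb u v); rewrite emb_child //; exact: emb_bound.
have [-> _] := cone_repP (emb u' v'); rewrite emb_child //; exact: emb_bound.
Qed.

Lemma size_stack v : size (stack v) = (lvl v).+1.
Proof.
move E : (lvl v) => k; elim: k v E => [|k IH] v E; first by rewrite /stack E.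
by rewrite (@stackS v) ?E // size_rcons IH // parent_dist E.
Qed.

Lemma parent_distS v : 0 < lvl v -> lvl v = (lvl (parent v)).+1.
Proof. by rewrite parent_dist => /prednK. Qed.

(** From the bottom up, each symbol identifies a cone inside the chart of its predecessor, and
    injectivity of the chart pulls it back to [G]. *)
Lemma stack_inj v w : stack v = stack w -> coned x0 v w.
Proof.
move E : (lvl v) => k; elim: k v w E => [|k IH] v w E vw.
  have := size_stack w; rewrite -vw size_stack E => -[/esym w0].
  by rewrite (dist_eq0 E) (dist_eq0 w0); apply: coned_refl.
have E' : lvl w = k.+1.
  by have := size_stack w; rewrite -vw size_stack E => -[].
have v0 : 0 < lvl v by rewrite E.
have w0 : 0 < lvl w by rewrite E'.
move: vw; rewrite (stackS v0) (stackS w0) => /rcons_inj[us dE].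
have uc : coned x0 (parent v) (parent w) by apply: IH us; rewrite parent_dist E.
have pw : cone x0 (parent v) w by apply/(coned_cone w uc)/parent_cone.
have [ue _] := chart_coned uc; rewrite -ue in dE.
have c : coned x0 (emb (parent v) v) (emb (parent v) w).
  apply: name_child_inj dE => //; try exact: parent_cone.
  - exact: parent_distS.
  - by have [<- _] := uc; exact: parent_distS.
have fE := emb_map (parent v); have pv := parent_cone v.
have fv := end_map_restrict fE pv; split; first by rewrite E E'.
have [z vz zw] := end_map_surj fv c.2.
by rewrite -(end_map_inj fE _ _ zw) //; apply: cone_sub pv vz.
Qed.

Definition cone_code v := (name (emb v v), stack v).

Lemma name_emb_inj v w : name (emb v v) = name (emb w w) -> emb v v = emb w w.
Proof. by apply: name_inj; apply/ltnW/emb_bound. Qed.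

Lemma cone_code_inj : injective cone_code.
Proof.
move=> v w [/name_emb_inj vw /stack_inj c]; have [ce _] := chart_coned c.
rewrite -ce in vw; have [_ cw] := c.
exact: (end_map_inj (emb_map v)) (cone_refl _ _) cw vw.
Qed.

Lemma chart_child u v : cone x0 u v -> lvl v = (lvl u).+1 ->
  emb v = type_map (emb u v) \o emb u /\
  stack v = rcons (stack u) (Some (name (cone_rep (emb u v)))).
Proof.
move=> uv E; have v0 : 0 < lvl v by rewrite E.
have c : coned x0 u (parent v).
  by apply: coned_parent uv (parent_cone v); rewrite parent_dist E.
by have [ue us] := chart_coned c; rewrite (embS v0) (stackS v0) ue us.
Qed.

(** Equal state and top symbol put [v] and [v'] at the same point of one cone in the charts of their
    predecessors. The edge is copied from one chart to the other; it pops, keeps or pushes a symbol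
    according to the change of level. *)
Lemma cone_code_local v v' a w' q s xi xi' :
  cone_code v = (q, rcons xi s) -> cone_code v' = (q, rcons xi' s) ->
  arrow v' a w' ->
  exists w p gamma, [/\ arrow v a w, cone_code w = (p, xi ++ gamma) &
    cone_code w' = (p, xi' ++ gamma)].
Proof.
move=> [qv Ev] [+ Ev'] vw'; rewrite -qv => /name_emb_inj qv'.
have [v0|v0] := posnP (lvl v).
  have v'0 : lvl v' = 0.
    apply/eqP; rewrite -leqn0 leqNgt; apply/negP => v'0.
    move: Ev'; rewrite (stackS v'0) => /rcons_inj[_ sE]; move: Ev.
    by rewrite /stack v0 /= -sE -[[:: None]]/(rcons [::] None) => /rcons_inj[].
  have nil t eta : lvl t = 0 -> stack t = rcons eta s -> eta = [::].
    by move=> t0 tE; have := size_stack t; rewrite tE t0 size_rcons; case: (eta).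
  rewrite (nil _ _ v0 Ev) (nil _ _ v'0 Ev') (dist_eq0 v0) -(dist_eq0 v'0).
  by exists w', (name (emb w' w')), (stack w').
have v'0 : 0 < lvl v'.
  rewrite lt0n; apply/eqP => v'0; move: Ev; rewrite (stackS v0) => /rcons_inj[_ sE].
  by move: Ev'; rewrite /stack v'0 /= -sE -[[:: None]]/(rcons [::] None) => /rcons_inj[].
have vu := parent_distS v0; have vu' := parent_distS v'0.
have uv := parent_cone v; have uv' := parent_cone v'.
have := chart_child uv vu; have := chart_child uv' vu'.
move: (parent v) (parent v') uv uv' vu vu' => u u' uv uv' vu vu' [fv' sv'] [fv sv].
move: (sv) (sv'); rewrite Ev Ev' => /rcons_inj[exi es] /rcons_inj[exi'].
rewrite es => -[sE].
have c := name_child_inj uv vu uv' vu' sE.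
(* The states agree after the common map [type_map]; its injectivity moves the equality to the
   charts of the predecessors. *)
have zE : emb u' v' = emb u v.
  move: qv'; rewrite fv fv' /= -(type_map_eq c); have [i tE] := type_mapP (emb u v).
  by apply: (end_map_inj tE); [case: c | apply: cone_refl].
have uE := emb_map u; have uE' := emb_map u'.
have zu := end_map_cone uE uv; have zu' := end_map_cone uE' uv'; rewrite zE in zu'.
have cu : coned x0 (emb u u) (emb u' u').
  apply: coned_parent zu zu'; have := emb_child uv' vu'; rewrite zE emb_child //.
  by case.
(* An edge changes the level by at most one, so [w'] is still in the cone of [u'] and has a
   counterpart [w] in the cone of [u]. *)
have lw' := arrow_dist x0 vw'; have lv' := arrow_dist x0 (arrow_sym vw').
have uw' : cone x0 u' w' by apply: cone_arrow uv' vw' _; rewrite vu' in lv'.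
have [w uw ww'] := end_map_surj uE ((coned_cone _ cu).2 (end_map_cone uE' uw')).
have vw : arrow v a w.
  by apply/(end_map_arrow uE _ uv uw); rewrite ww' -zE -(end_map_arrow uE' _ uv' uw').
have [lu _] := cu.
have lww' : lvl w + lvl u' = lvl w' + lvl u.
  by have := end_map_dist uE uw; have := end_map_dist uE' uw'; rewrite ww' lu; lia.
exists w; have [lw|lw] := ltnP (lvl w') (lvl v').
  have [cw cw'] : coned x0 u w /\ coned x0 u' w' by split; split=> //; lia.
  have [eu su] := chart_coned cw; have [eu' su'] := chart_coned cw'.
  exists (name (emb w w)), [::]; rewrite /cone_code exi exi' !cats0 -eu -eu' -su -su' ww'.
  by split.
have cvw' : cone x0 v' w' by apply: cone_arrow (cone_refl _ _) vw' lw.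
have cvw : cone x0 v w by apply: cone_arrow (cone_refl _ _) vw _; lia.
have evw : emb v w = emb v' w' by rewrite fv fv' /= -(type_map_eq c) ww'.
have [lw1|lw1] := eqVneq (lvl w') (lvl v').
  have [cw cw'] : coned x0 v w /\ coned x0 v' w' by split; split=> //; lia.
  have [ev sv1] := chart_coned cw; have [ev' sv1'] := chart_coned cw'.
  exists (name (emb w w)), [:: s]; rewrite /cone_code !cats1.
  by rewrite -ev -ev' -sv1 -sv1' evw -Ev -Ev'.
have [|ew sw] := chart_child cvw; first by lia.
have [|ew' sw'] := chart_child cvw'; first by lia.
exists (name (emb w w)), [:: s; Some (name (cone_rep (emb v w)))].
rewrite -!cat_rcons !cats0 -Ev -Ev' /cone_code sw sw' evw; split=> //.
by rewrite ew ew' /= evw.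
Qed.

End ConeCoding.

Lemma coding_of_context_free (A : finType) (G : inverse_graph A) (x0 : G) :
  context_free_graph x0 -> exists (M : pda A) (code : G -> config M), coding x0 code.
Proof.
move=> [n [r rP]]; apply: (local_coding (@cone_code_inj _ _ _ _ _ rP)).
- by rewrite /cone_code /stack dist0.
- by move=> v; rewrite -size_eq0 size_stack.
- exact: cone_code_local.
Qed.

(** * Context-free grammars *)

(** Derivation forests; unlike rewriting sequences they allow structural induction on how a word is
    produced. *)
Inductive derives (T : finType) (g : cfg T) :
    seq (nonterminal g + T) -> seq T -> Prop :=
  | derives_nil : derives [::] [::]
  | derives_letter a alpha w :
      derives alpha w -> derives (inr a :: alpha) (a :: w)
  | derives_rule X rhs alpha u w : (X, rhs) \in productions g ->
      derives rhs u -> derives alpha w -> derives (inl X :: alpha) (u ++ w).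

Section Derivations.
Variables (T : finType) (g : cfg T).
Implicit Types (alpha beta : seq (nonterminal g + T)) (u w : seq T).
Notation steps := (clos_refl_trans _ (@cfg_step T g)).

Lemma derives_cat alpha beta u w :
  derives alpha u -> derives beta w -> derives (alpha ++ beta) (u ++ w).
Proof.
move=> au bw; elim: au => [//|a al v _ IH|X rhs al v v' gX rv _ _ IH] /=.
  exact: derives_letter.
by rewrite -catA; apply: derives_rule gX rv IH.
Qed.

Lemma derives_catI alpha beta w : derives (alpha ++ beta) w ->
  exists u v, [/\ w = u ++ v, derives alpha u & derives beta v].
Proof.
elim: alpha w => [|[X|a] alpha IH] w /=.
- by exists [::], w; split=> //; apply: derives_nil.
- move E : (_ :: _) => ab abw; case: abw E => // Y rhs al v w' gY rv aw [XY E].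
  rewrite -XY in gY; rewrite -E in aw; have [u [u' [-> au bu']]] := IH _ aw.
  exists (v ++ u), u'; rewrite catA; split=> //; exact: derives_rule gY rv au.
- move E : (_ :: _) => ab abw; case: abw E => // b al w' aw [<- E].
  rewrite -E in aw; have [u [u' [-> au bu']]] := IH _ aw.
  by exists (a :: u), u'; split=> //; apply: derives_letter.
Qed.

Lemma derives_word w : derives (g := g) (map inr w) w.
Proof. by elim: w => [|a w IH]; [apply: derives_nil | apply: derives_letter]. Qed.

Lemma cfg_steps_ctx l r alpha beta :
  steps alpha beta -> steps (l ++ alpha ++ r) (l ++ beta ++ r).
Proof.
elim=> [a b [l' [r' [X [rhs [gX -> ->]]]]]|a|a b c _ IH1 _ IH2].
- apply: rt_step; exists (l ++ l'), (r' ++ r), X, rhs.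
  by split=> //; rewrite -!catA ?cat_cons -?catA.
- exact: rt_refl.
- exact: rt_trans IH1 IH2.
Qed.

Lemma derives_steps alpha w : derives alpha w <-> steps alpha (map inr w).
Proof.
split=> [|s].
  elim=> [|a al v _ IH|X rhs al u v gX _ IHu _ IHv]; first exact: rt_refl.
    by have := cfg_steps_ctx [:: inr a] [::] IH; rewrite !cats0.
  apply: (@rt_trans _ _ _ (rhs ++ al)).
    by apply: rt_step; exists [::], al, X, rhs.
  rewrite map_cat; apply: (@rt_trans _ _ _ (map inr u ++ al)).
    exact: (cfg_steps_ctx [::]).
  by have := cfg_steps_ctx (map inr u) [::] IHv; rewrite !cats0.
have := clos_rt_rt1n _ _ _ _ s; move E : (map inr w) => b r.
elim: r E => [a <-|a c d [l [r [X [rhs [gX -> ->]]]]] _ IH /IH]; first exact: derives_word.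
move=> /derives_catI[u [v [-> lu /derives_catI[v1 [v2 [-> rv1 rv2]]]]]].
apply: derives_cat lu _; exact: derives_rule gX rv1 rv2.
Qed.

Lemma cfg_langE w : cfg_lang g w <-> derives [:: inl (start g)] w.
Proof. by rewrite derives_steps. Qed.

Section Interpretation.
Variable sem : nonterminal g -> seq T -> Prop.

Fixpoint sem_form alpha w : Prop :=
  match alpha with
  | [::] => w = [::]
  | inr a :: alpha' => exists2 v, w = a :: v & sem_form alpha' v
  | inl X :: alpha' => exists u v, [/\ w = u ++ v, sem X u & sem_form alpha' v]
  end.

Lemma derives_sound alpha w :
  (forall X rhs u, (X, rhs) \in productions g -> sem_form rhs u -> sem X u) ->
  derives alpha w -> sem_form alpha w.
Proof.
move=> semP; elim=> [//|a al v _ IH|X rhs al u v gX _ IHu _ IHv] /=; first by exists v.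
by exists u, v; split=> //; apply: semP gX IHu.
Qed.

End Interpretation.
End Derivations.

Section RuleGrammar.
Variables (T N : finType) (s : N) (rule : N -> seq (N + T) -> Prop).

(** The finite list of productions is obtained by filtering the finite type of right-hand sides of
    length at most 2 by an arbitrary proposition. *)
Definition rule_cfg : cfg T :=
  @Cfg T N s [seq (x.1, val x.2) |
    x <- enum {: N * 2.-bseq (N + T)} & `[< rule x.1 (val x.2) >]].

Lemma rule_cfgP X rhs :
  (X, rhs) \in productions rule_cfg <-> rule X rhs /\ size rhs <= 2.
Proof.
split=> [/mapP[[Y b]]|[r s2]].
  by rewrite mem_filter => /andP[/asboolP r _] [-> ->]; split=> //; apply: size_bseq.
apply/mapP; exists (X, Bseq s2) => //.
by rewrite mem_filter mem_enum andbT; apply/asboolP.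
Qed.

End RuleGrammar.

(** * Languages of pushdown automata *)

Section RunLanguage.
Variables (A : finType) (M : pda A).
Notation Q := (state M).
Notation S := (stack_symbol M).
Notation step := (@step A M).

Fixpoint run (c : config M) (w : seq (letter A)) (d : config M) : Prop :=
  match w with
  | [::] => c = d
  | a :: w' => exists2 c', step c a c' & run c' w' d
  end.

Lemma run_cat c u d w e : run c u d -> run d w e -> run c (u ++ w) e.
Proof.
elim: u c => [|a u IH] c /= => [-> //|[c' cc' /IH ce] /ce]; by exists c'.
Qed.

Lemma step_nil p a d : ~ step (p, [::] : seq S) a d.
Proof. by move=> [q [p' [xi [x [gamma [[_ +] _ _]]]]]]; case: xi. Qed.

Lemma step_frame p xi eta x a d : step (p, xi ++ rcons eta x) a d ->
  exists q zeta, d = (q, xi ++ zeta) /\ step (p, rcons eta x) a (q, zeta).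
Proof.
move=> [p' [q [xi' [x' [gamma [[-> +] dE ->]]]]]].
rewrite -rcons_cat => /rcons_inj[<- ->].
exists q, (eta ++ gamma); rewrite catA; split=> //.
by exists p', q, eta, x', gamma.
Qed.

Lemma run_frame p xi eta w q eta' :
  run (p, eta) w (q, eta') -> run (p, xi ++ eta) w (q, xi ++ eta').
Proof.
elim: w p eta => [|a w IH] p eta /=; first by move=> [-> ->].
move=> [[p' zeta] [p1 [q1 [xi1 [x [gamma [[-> ->] dE [-> ->]]]]]]] /IH r].
exists (q1, xi ++ xi1 ++ gamma) => //.
by exists p1, q1, (xi ++ xi1), x, gamma; rewrite -rcons_cat catA.
Qed.

(** In the second case the part [eta] above [xi] is popped entirely after [u]; until then the run
    cannot see [xi]. *)
Lemma run_split p xi eta w q xi' : run (p, xi ++ eta) w (q, xi') ->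
  (exists2 eta', xi' = xi ++ eta' & run (p, eta) w (q, eta')) \/
  (exists t u v, [/\ w = u ++ v, run (p, eta) u (t, [::]) &
    run (t, xi) v (q, xi')]).
Proof.
elim: w p eta => [|a w IH] p eta /=; first by move=> [-> <-]; left; exists eta.
case/lastP: eta => [|eta x].
  by rewrite cats0 => r; right; exists p, [::], (a :: w).
move=> [d /step_frame[p' [zeta [-> s]]] /IH[[eta' -> r]|[t [u [v [-> r1 r2]]]]]].
  by left; exists eta' => //; exists (p', zeta).
by right; exists t, (a :: u), v; split=> //; exists (p', zeta).
Qed.

Definition delta_bound : nat :=
  \max_(x : Q * letter A * S)
    (if @delta A M x.1.1 x.1.2 x.2 is Some o then size o.2 else 0).

Lemma delta_boundP p a x q gamma :
  @delta A M p a x = Some (q, gamma) -> size gamma <= delta_bound.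
Proof.
move=> dE; pose F (x : Q * letter A * S) :=
  if @delta A M x.1.1 x.1.2 x.2 is Some o then size o.2 else 0.
by have := leq_bigmax (F := F) (p, a, x); rewrite {1}/F /= dE.
Qed.

Variables (c0 : config M) (F : set (config M)) (K : nat).
Hypotheses (c0K : size c0.2 <= K) (FK : forall d, F d -> size d.2 <= K).
Hypothesis deltaK : delta_bound <= K.

Definition pack (c : config M) : Q * K.-bseq S := (c.1, insub_bseq K c.2).
Definition unpack (c : Q * K.-bseq S) : config M := (c.1, val c.2).

Lemma packK c : size c.2 <= K -> unpack (pack c) = c.
Proof. by case: c => p xi xiK; rewrite /unpack /pack val_insubd xiK. Qed.

(* [Some (c, d)] generates the words leading from [c] to [d]; [None] is the start. *)
Definition run_symbol : finType := option ((Q * K.-bseq S) * (Q * K.-bseq S)).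

Definition run_from_to (c d : config M) : run_symbol := Some (pack c, pack d).

(** A variant of the triple construction: [run_pop] and [run_keep] isolate the top of the stack,
    following the two cases of [run_split], and [run_step] reads a letter. *)
Inductive run_rule : run_symbol -> seq (run_symbol + letter A) -> Prop :=
  | run_start d : F d -> run_rule None [:: inl (run_from_to c0 d)]
  | run_stop c : run_rule (run_from_to c c) [::]
  | run_step c a c1 d : size c.2 <= K -> size c1.2 <= K -> step c a c1 ->
      run_rule (run_from_to c d) [:: inr a; inl (run_from_to c1 d)]
  | run_pop p xi x t d : size (rcons xi x) <= K ->
      run_rule (run_from_to (p, rcons xi x) d)
        [:: inl (run_from_to (p, [:: x]) (t, [::])); inl (run_from_to (t, xi) d)]
  | run_keep p xi x q eta : size (rcons xi x) <= K -> size (xi ++ eta) <= K ->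
      run_rule (run_from_to (p, rcons xi x) (q, xi ++ eta))
        [:: inl (run_from_to (p, [:: x]) (q, eta))].

Definition run_cfg : cfg (letter A) := rule_cfg None run_rule.

Definition run_sem (X : run_symbol) (w : seq (letter A)) : Prop :=
  match X with
  | Some (c, d) => run (unpack c) w (unpack d)
  | None => exists2 d, F d & run c0 w d
  end.

Lemma run_cfg_sound X w : derives (g := run_cfg) [:: inl X] w -> run_sem X w.
Proof.
move=> Xw; suff /derives_sound/(_ Xw)[u [v [-> Xu ->]]] : forall Y rhs u,
    (Y, rhs) \in productions run_cfg -> @sem_form _ run_cfg run_sem rhs u -> run_sem Y u.
  by rewrite cats0.
move=> Y rhs u /rule_cfgP[r _].
case: r => [d Fd|c|c a c1 d cK c1K s|p xi x t d xK|p xi x q eta xK eK] /=.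
- by move=> [v [v1 [-> + ->]]]; rewrite cats0 (packK c0K) (packK (FK Fd)) => r; exists d.
- by move=> ->.
- move=> [v -> [v1 [v2 [-> + ->]]]]; rewrite cats0 !(packK cK) !(packK c1K) => r.
  by exists c1.
- have x1K : size [:: x] <= K by move: xK; rewrite size_rcons; case: (K).
  have xiK : size xi <= K by move: xK; rewrite size_rcons; apply: ltnW.
  move=> [u1 [u2 [-> + [u3 [u4 [-> + ->]]]]]]; rewrite cats0.
  rewrite (@packK (p, [:: x])) // (@packK (t, [::])) // (@packK (t, xi)) //.
  rewrite (@packK (p, rcons xi x)) // => r1 r2.
  by apply: run_cat r2; rewrite -cats1 -[xi in (t, xi)]cats0; apply: run_frame.
- have x1K : size [:: x] <= K by move: xK; rewrite size_rcons; case: (K).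
  have etaK : size eta <= K by move: eK; rewrite size_cat; apply: leq_trans (leq_addl _ _).
  move=> [u1 [u2 [-> + ->]]]; rewrite cats0 !packK // => r.
  by rewrite -cats1; apply: run_frame.
Qed.

Lemma run_rule_derives1 X Y w : run_rule X [:: inl Y] ->
  derives (g := run_cfg) [:: inl Y] w -> derives (g := run_cfg) [:: inl X] w.
Proof.
move=> r Yw; rewrite -[w]cats0; apply: derives_rule Yw (derives_nil _).
exact/rule_cfgP.
Qed.

Lemma run_cfg_complete c w d : size c.2 <= K -> size d.2 <= K -> run c w d ->
  derives (g := run_cfg) [:: inl (run_from_to c d)] w.
Proof.
(* A letter weighs more than any stack of height at most [K], so the measure drops both when a
   letter is read and when only the top symbol of a longer stack is kept. *)
have [m] := ubnP (size w * K.+2 + size c.2); elim: m c w d => // m IH.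
move=> [p xi] w [q xi'] /=; case: w => [|a w] wm xiK xi'K /=.
  move=> [<- <-]; rewrite -[[::]]/([::] ++ [::]).
  apply: derives_rule (derives_nil _) (derives_nil _); apply/rule_cfgP; split=> //.
  exact: run_stop.
case/lastP: xi xiK wm => [|xi x] xiK wm; first by move=> [d /step_nil].
have x1K : size [:: x] <= K by move: xiK; rewrite size_rcons; case: (K).
have xK : size xi <= K by move: xiK; rewrite size_rcons; apply: ltnW.
have [->|xin] := eqVneq xi [::].
  move=> [d s r]; have dK : size d.2 <= K.
    move: s => [p1 [q1 [xi1 [x1 [gamma [[_ +] dE ->]]]]]].
    rewrite -[[:: x]]/(rcons [::] x) => /rcons_inj[<- _] /=.
    exact: leq_trans (delta_boundP dE) deltaK.
  have dw : derives (g := run_cfg) [:: inl (run_from_to d (q, xi'))] w.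
    by apply: IH => //; move: wm dK; rewrite size_rcons /=; lia.
  rewrite -[a :: w]cats0; apply: derives_rule _ (derives_letter a dw) (derives_nil _).
  by apply/rule_cfgP; split=> //; apply: run_step s.
have xi0 : 0 < size xi by rewrite lt0n size_eq0.
move=> r; have {r} : run (p, xi ++ [:: x]) (a :: w) (q, xi') by rewrite cats1.
move=> /run_split[[eta E r]|[t [u [v [E r1 r2]]]]].
  have etaK : size eta <= K.
    by move: xi'K; rewrite E size_cat; apply: leq_trans (leq_addl _ _).
  rewrite E; apply: (@run_rule_derives1 _ (run_from_to (p, [:: x]) (q, eta))).
    by apply: run_keep; rewrite // -E.
  by apply: IH => //; move: wm; rewrite size_rcons /=; lia.
have -> : a :: w = (u ++ v ++ [::]) ++ [::] by rewrite !cats0.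
have u0 : 0 < size u by case: (u) r1 => // -[].
have uv : (size w).+1 = size u + size v by rewrite -size_cat -E.
apply: (@derives_rule _ run_cfg _
  [:: inl (run_from_to (p, [:: x]) (t, [::])); inl (run_from_to (t, xi) (q, xi'))]).
- by apply/rule_cfgP; split=> //; apply: run_pop.
- have uw : size u * K.+2 <= (size w).+1 * K.+2.
    by rewrite leq_mul2r uv leq_addr orbT.
  have vw : (size v).+1 * K.+2 <= (size w).+1 * K.+2.
    by rewrite leq_mul2r; apply/orP; right; lia.
  rewrite mulSn in vw; rewrite size_rcons /= in wm; rewrite cats0 -cat1s; apply: derives_cat.
    by apply: IH => //=; move: uw wm xi0 => /=; lia.
  by apply: IH => //=; move: vw wm => /=; lia.
- exact: derives_nil.
Qed.

End RunLanguage.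

Lemma run_lang_context_free (A : finType) (M : pda A) (c0 : config M)
    (F : set (config M)) (K : nat) :
  (forall d, F d -> size d.2 <= K) ->
  context_free_lang [set w | exists2 d, F d & run c0 w d]%classic.
Proof.
pose L := maxn K (maxn (size c0.2) (delta_bound M)) => FK.
have FL d : F d -> size d.2 <= L by move/FK; rewrite leq_max => ->.
have c0L : size c0.2 <= L by rewrite !leq_max leqnn orbT.
have dL : delta_bound M <= L by rewrite !leq_max leqnn !orbT.
exists (run_cfg c0 F L); apply/seteqP; split=> w /=.
  by move=> /cfg_langE/(run_cfg_sound c0L FL).
move=> [d Fd r]; apply/cfg_langE.
apply: (@run_rule_derives1 _ _ _ _ _ _ (run_from_to L c0 d)); first exact: run_start.
by apply: run_cfg_complete r => //; apply: FL.
Qed.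

(** Runs from [code y0] spell the walks from [y0], whatever the root of the coding is. This allows
    the change of root. *)
Lemma walk_lang_context_free (A : finType) (G : inverse_graph A) (x0 y0 : G)
    (M : pda A) (code : G -> config M) (F : set G) :
  coding x0 code -> finite_set F -> context_free_lang (walk_lang y0 F).
Proof.
move=> codeP Ffin; have [code_inj _ code_step] := codeP.
have [s sE] : exists s : seq nat, [set` s]%classic = ((size \o snd \o code) @` F)%classic.
  by have /finite_seqP[s ->] := finite_image (size \o snd \o code) Ffin; exists s.
have [g gE] : context_free_lang
    [set w | exists2 d, (code @` F)%classic d & run (code y0) w d]%classic.
  apply: (@run_lang_context_free _ _ _ _ (\max_(i <- s) i)) => _ [v Fv <-].
  apply: (@leq_bigmax_seq _ s xpredT id) => //.
  suff : ([set` s]%classic) (size (code v).2) by [].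
  by rewrite sE; exists v.
exists g; rewrite gE; apply/seteqP.
have runE v w y : run (code v) w (code y) <-> trace predT v w y.
  elim: w v => [|a w IH] v /=; first by split=> [/code_inj|->].
  split=> [[c /code_step[z vz ->] /IH zy]|[z [vz _ /IH zy]]]; first by exists z.
  by exists (code z) => //; apply/code_step; exists z.
split=> w; first by move=> [_ [y Fy <-] /runE r]; apply/walk_langE; exists y.
by move=> /walk_langE[y Fy /runE r]; exists (code y) => //; exists y.
Qed.

(** * From a context-free language to finitely many end-cones *)

Lemma eq_catP (T : Type) (a b c d : seq T) : a ++ b = c ++ d ->
  (exists e, c = a ++ e /\ b = e ++ d) \/ (exists e, a = c ++ e /\ d = e ++ b).
Proof.
elim: a c => [|x a IH] [|y c] /=; first by move=> ->; left; exists [::].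
- by move=> ->; left; exists (y :: c).
- by move=> <-; right; exists (x :: a).
- by move=> [-> /IH[[e [-> ->]]|[e [-> ->]]]]; [left | right]; exists e.
Qed.

Section Items.
Variables (T : finType) (g : cfg T).

(* The suffixes of right-hand sides make derivation trees binary; the empty form
   and the single letters are added so that labels also record equality and
   adjacency of vertices. *)
Definition items : seq (seq (nonterminal g + T)) :=
  [:: [::]; [:: inl (start g)]] ++ [seq [:: inr a] | a <- enum T] ++
  flatten [seq [seq drop i x.2 | i <- iota 0 (size x.2).+1] | x <- productions g].

Lemma items_nil : [::] \in items.
Proof. by []. Qed.

Lemma items_start : [:: inl (start g)] \in items.
Proof. by rewrite !inE eqxx orbT. Qed.

Lemma items_letter a : [:: inr a] \in items.
Proof. by rewrite !inE mem_cat map_f ?orbT // mem_enum. Qed.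

Lemma items_drop X rhs i : (X, rhs) \in productions g -> drop i rhs \in items.
Proof.
move=> gX; rewrite !inE mem_cat; do 3 (apply/orP; right).
have [ir|/ltnW ri] := leqP i (size rhs).
  apply/flatten_mapP; exists (X, rhs) => //.
  by apply: (map_f (fun i => drop i rhs)); rewrite mem_iota.
have -> : drop i rhs = drop (size rhs) rhs by rewrite drop_size drop_oversize.
apply/flatten_mapP; exists (X, rhs) => //.
by apply: (map_f (fun i => drop i rhs)); rewrite mem_iota /=.
Qed.

Lemma items_rhs X rhs : (X, rhs) \in productions g -> rhs \in items.
Proof. by move=> gX; rewrite -[rhs]drop0; apply: items_drop gX. Qed.

Lemma items_tail s alpha : (s :: alpha) \in items -> alpha \in items.
Proof.
rewrite inE => /orP[//|]; rewrite inE => /orP[/eqP[_ ->] //|].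
rewrite mem_cat => /orP[/mapP[a _ [_ ->]] //|/flatten_mapP[[X rhs] gX /mapP[i _ E]]].
suff -> : alpha = drop i.+1 rhs by apply: items_drop gX.
by move: E => /= E; rewrite -add1n -drop_drop -E /= drop0.
Qed.

Lemma yield_bound (l : seq (seq (nonterminal g + T))) : exists m,
  forall alpha w, alpha \in l -> derives alpha w ->
    exists2 u, derives alpha u & size u <= m.
Proof.
elim: l => [|beta l [m IH]]; first by exists 0.
have [[v bv]|no] := pselect (exists v, derives beta v).
  exists (maxn (size v) m) => alpha w; rewrite inE => /orP[/eqP -> _|al aw].
    by exists v => //; rewrite leq_maxl.
  by have [u au um] := IH _ _ al aw; exists u => //; rewrite leq_max um orbT.
exists m => alpha w; rewrite inE => /orP[/eqP -> bw|al]; last exact: IH.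
by case: no; exists w.
Qed.

End Items.

(** * Cutting walks in a cone into pieces with bounded chords *)

Section ConeTypes.
Variables (A : finType) (G : inverse_graph A) (x0 : G) (g : cfg (letter A)).
Hypothesis gP : forall w, derives (g := g) [:: inl (start g)] w <-> trace predT x0 w x0.
Variable m : nat.
Hypothesis mP : forall alpha w, alpha \in items g -> derives alpha w ->
  exists2 u, derives alpha u & size u <= m.
Notation lvl := (dist x0).
Notation tr := (trace predT).
Notation form := (seq (nonterminal g + letter A)).
Implicit Types (x y c d e p q v : G) (u w z s t : seq (letter A)) (alpha : form).

(** The condition bears on all yields of [alpha], so a long yield may be exchanged for a short one
    with the same ends. *)
Definition labels alpha x y : Prop := forall w, derives alpha w -> tr x w y.

Definition near k x y : Prop := exists2 w, size w <= k & tr x w y.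

Lemma near_refl k x : near k x x.
Proof. by exists [::]. Qed.

Lemma near_sym k x y : near k x y -> near k y x.
Proof.
move=> [w wk xy]; exists (word_inv w); last exact: trace_sym.
by rewrite size_rev size_map.
Qed.

Lemma near_trans k l x y e : near k x y -> near l y e -> near (k + l) x e.
Proof.
move=> [u uk xy] [w wl yz]; exists (u ++ w); last by apply/trace_catP; exists y.
by rewrite size_cat leq_add.
Qed.

Lemma near_leq k l x y : k <= l -> near k x y -> near l x y.
Proof. by move=> kl [w wk xy]; exists w => //; apply: leq_trans wk kl. Qed.

Lemma near_dist k x y : near k x y -> lvl y <= lvl x + k.
Proof. by move=> [w wk /(dist_trace_le x0)]; lia. Qed.

Lemma labels_near alpha w x y :
  alpha \in items g -> derives alpha w -> labels alpha x y -> near m x y.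
Proof. by move=> al aw lab; have [u au um] := mP al aw; exists u; last apply: lab. Qed.

(** A factorization of the word into yields of items; [P] is required at the end of each piece, not
    at the starting vertex. *)
Inductive chain (P : G -> Prop) : G -> seq (letter A) -> G -> Prop :=
  | chain_nil d : chain P d [::] d
  | chain_cons c alpha u c' z d : alpha \in items g -> derives alpha u ->
      labels alpha c c' -> P c' -> chain P c' z d -> chain P c (u ++ z) d.

Lemma chain_cat P c u d w e : chain P c u d -> chain P d w e -> chain P c (u ++ w) e.
Proof.
move=> cd de; elim: cd de => [//|c1 al v c2 z d' ai av lab Pc _ IH /IH].
by rewrite -catA; apply: chain_cons lab Pc.
Qed.

Lemma chain1 (P : G -> Prop) alpha u c d : alpha \in items g -> derives alpha u ->
  labels alpha c d -> P d -> chain P c u d.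
Proof.
by move=> ai au lab Pd; rewrite -[u]cats0; apply: chain_cons lab Pd (chain_nil _ _).
Qed.

Lemma labels_nil x y : labels [::] x y <-> x = y.
Proof.
split=> [lab|-> w]; first exact: (lab _ (derives_nil _)).
by move E : (@nil _) => f fw; case: fw E.
Qed.

Lemma labels_letter a x y : labels [:: inr a] x y <-> arrow x a y.
Proof.
split=> [lab|xy w].
  have [|z [xz _ /= <- //]] := lab [:: a].
  exact: derives_letter (derives_nil _).
move E : [:: inr a] => f fw; case: fw E => // b al v av [<- E].
by rewrite -E in av; exists y; split=> //; exact: (labels_nil y y).2 erefl _ av.
Qed.

Section Decomposition.
Variables (n : nat) (d0 d1 : G).

Definition near_ends c : Prop := near (m + m) d0 c \/ near (m + m) d1 c.

(** Invariant for the part [u] of the yield left of the cone walk: either it is used up and [d] is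
    near an end, or [d] is [d0] and [u] is short enough to be the end of a geodesic from the root to
    level [n]. [end_right] is the mirror image. *)
Let end_left u p d : Prop :=
  (u = [::] /\ near_ends d) \/ (d = d0 /\ size u + lvl p <= n).
Let end_right w q d : Prop :=
  (w = [::] /\ near_ends d) \/ (d = d1 /\ size w + lvl q <= n).

(** A point [e] of level at least [n] within [m] of [p] forces [p] to level at least [n - m]. Then
    [u] has length at most [m], and [e] is within [m + m] of [d0]. *)
Lemma near_left u p e : size u + lvl p <= n -> tr p u d0 -> near m p e ->
  n <= lvl e -> near_ends e.
Proof.
move=> un pd pe ne; have := near_dist pe; left; apply: near_trans pe; apply/near_sym.
by exists u => //; lia.
Qed.

Lemma near_right w q e : size w + lvl q <= n -> tr d1 w q -> near m e q ->
  n <= lvl e -> near_ends e.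
Proof.
move=> wn dq /near_sym qe ne; have := near_dist qe; right; apply: near_trans qe.
by exists w => //; lia.
Qed.

(** Induction on the derivation. The cut between head symbol and tail either misses the inside of
    [z], and one part carries all of [z], or falls inside it; if [u] or [w] is non-empty, the cut
    point is then joined by a chord to a point of a geodesic and so lies near [d0] or [d1]. *)
Lemma derives_chain alpha W : derives alpha W -> alpha \in items g ->
  forall u z w p d d' q, W = u ++ z ++ w -> labels alpha p q ->
    tr p u d -> trace (above x0 n) d z d' -> tr d' w q -> n <= lvl d ->
    end_left u p d -> end_right w q d' -> chain near_ends d z d'.
Proof.
have near_endsR w q d : end_right w q d -> near_ends d.
  by move=> [[]//|[-> _]]; right; apply: near_refl.
have base al W' u z w p d d' q : u = [::] -> w = [::] -> W' = u ++ z ++ w ->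
    derives al W' -> al \in items g -> labels al p q -> tr p u d -> tr d' w q ->
    end_right w q d' -> chain near_ends d z d'.
  move=> -> -> ->; rewrite cats0 /= => az ai lab <- E er; apply: chain1 ai az _ _.
    by rewrite -E in lab.
  exact: near_endsR er.
move=> aW; elim: aW.
- move=> ai u z w p d d' q; case: u => //; case: z => //; case: w => //.
  move=> E lab pd dd' d'q nd el er; apply: (base [::] [::]) E _ _ lab pd d'q er => //.
  exact: derives_nil.
- move=> a al W' aW' IH ai [|b u] z w p d d' q E lab pd dd' d'q nd el er.
    have [w0|w0] := eqVneq w [::].
      by apply: base E _ ai lab pd d'q er => //; apply: derives_letter.
    case: z E dd' => [_ <-|b z [<- E] [p' [ap np' p'd]]]; first exact: chain_nil.
    have pE : p = d by [].
    have al' := items_tail ai.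
    have lab' : labels al p' q.
      move=> y ay; have [t [pt _ tq]] := lab _ (derives_letter a ay).
      by rewrite pE in pt; rewrite (arrow_det ap pt).
    have Pp' : near_ends p'.
      case: er => [[w0' _]|[d'1 wn]]; first by rewrite w0' eqxx in w0.
      by apply: near_right wn _ (labels_near al' aW' lab') np'; rewrite -d'1.
    rewrite -cat1s; apply: (chain_cons (items_letter g a) _ _ Pp').
    + exact: derives_letter (derives_nil _).
    + exact/labels_letter.
    + exact: (IH al' [::] _ _ _ _ _ _ E lab' erefl p'd d'q np'
        (or_introl (conj erefl Pp')) er).
  case: E pd => <- E [p' [pp' _ p'd]].
  have lab' : labels al p' q.
    move=> y ay; have [t [pt _ tq]] := lab _ (derives_letter a ay).
    by rewrite (arrow_det pp' pt).
apply: IH E lab' p'd dd' d'q nd _ er; first exact: items_tail ai.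
  case: el => [[]//|[-> un]]; right; split=> //.
  by have := arrow_dist x0 pp'; move: un => /=; lia.
- move=> X rhs al W1 W2 gX rW1 IH1 aW2 IH2 ai u z w p d d' q E lab pd dd' d'q nd el er.
  have ri := items_rhs gX; have al' := items_tail ai.
  have [p1 pp1 p1q] : exists2 p1, tr p W1 p1 & tr p1 W2 q.
    by apply/trace_catP/lab; apply: derives_rule gX rW1 aW2.
  (* The yield of one half is fixed and that of the other varies; determinism, forwards or
     backwards, fixes the vertex [p1] between them. *)
  have lab1 : labels rhs p p1.
    move=> y ry; have /trace_catP[t pt tq] := lab _ (derives_rule gX ry aW2).
    by rewrite (trace_codet p1q tq).
  have lab2 : labels al p1 q.
    move=> y ay; have /trace_catP[t pt tq] := lab _ (derives_rule gX rW1 ay).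
    by rewrite (trace_det pp1 pt).
  have [[u2 [uE W2E]]|[z1 [W1E zE]]] := eq_catP E.
    move: pd; rewrite uE => /trace_catP[p1' pp1' p1d].
    rewrite -(trace_det pp1 pp1') in p1d.
    apply: IH2 W2E lab2 p1d dd' d'q nd _ er => //.
    case: el => [[u0 Pd]|[-> un]]; [left | right]; split=> //.
      by move: u0; rewrite uE; case: (W1).
    by have := dist_trace_le x0 pp1; move: un; rewrite uE size_cat; lia.
  have [[w1 [z1E wE]]|[z2 [zE' W2E]]] := eq_catP zE.
    move: d'q; rewrite wE => /trace_catP[p1' d'p1' p1q'].
    rewrite -(trace_codet p1q p1q') in d'p1'.
    apply: (IH1 ri u z w1 _ _ _ _ _ lab1 pd dd' d'p1' nd el); first by rewrite W1E z1E.
    case: er => [[w0 Pd]|[-> wn]]; [left | right]; split=> //.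
      by move: w0; rewrite wE; case: (w1).
    by have := dist_trace_ge x0 p1q; move: wn; rewrite wE size_cat; lia.
  move: dd'; rewrite zE' => /trace_catP[e de ed'].
  have pe : p1 = e.
    apply: (trace_det pp1 (Q := predT)); rewrite W1E; apply/trace_catP; exists d => //.
    exact: trace_predT de.
  rewrite pe in pp1 p1q lab1 lab2; have ne : n <= lvl e := trace_last nd de.
  have [[u0 w0]|ends] := pselect (u = [::] /\ w = [::]).
    rewrite -zE'; apply: base u0 w0 E _ ai lab pd d'q er.
    exact: derives_rule gX rW1 aW2.
  have Pe : near_ends e.
    case: el pd => [[u0 _] _|[-> un] pd].
      case: er d'q => [[w0 _]|[-> wn] d'q]; first by case: ends.
      exact: near_right wn d'q (labels_near al' aW2 lab2) ne.
    exact: near_left un pd (labels_near ri rW1 lab1) ne.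
  apply: (@chain_cat _ _ _ e).
    apply: (IH1 ri u z1 [::] p d e e _ lab1 pd de erefl nd el); first by rewrite cats0.
    by left.
  exact: (IH2 al' [::] z2 w e e d' q W2E lab2 erefl ed' d'q ne
    (or_introl (conj erefl Pe)) er).
Qed.

End Decomposition.
(** Geodesics from the root to [d0] and from [d1] back complete the walk to a loop at the root,
    whose word is derived from the start symbol. *)
Lemma cone_chain v d0 d1 z : coned x0 v d0 -> coned x0 v d1 ->
  trace (above x0 (lvl v)) d0 z d1 -> chain (near_ends d0 d1) d0 z d1.
Proof.
move=> [l0 _] [l1 _] dd; have [u xd us] := dist_trace x0 d0.
have [u' xd' us'] := dist_trace x0 d1; have dx := trace_sym isT xd'.
have sD : derives (g := g) [:: inl (start g)] (u ++ z ++ word_inv u').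
  apply/gP/trace_catP; exists d0 => //; apply/trace_catP; exists d1 => //.
  exact: trace_predT dd.
apply: (derives_chain (n := lvl v) sD (items_start g) erefl _ xd dd dx).
- by move=> w /gP.
- by rewrite l0.
- by right; rewrite us dist0 l0 addn0.
- by right; rewrite size_rev size_map us' dist0 l1 addn0.
Qed.

Definition width := m + m + m + (m + m).

(** Either all cut points of the chain up to [d1] stay within [m + m] of [d0], or one piece, of
    chord at most [m], leads from there to within [m + m] of [d1]. *)
Lemma coned_near d0 d1 : coned x0 d0 d1 -> near width d0 d1.
Proof.
move=> dd; have [_ [z /(cone_chain (coned_refl _ _) dd)]] := dd.
suff c_near c y e : chain (near_ends d0 y) c z e -> y = e ->
    near (m + m) d0 c -> near width d0 e.
  by move=> /c_near; apply=> //; apply: near_refl.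
elim=> [d dE|c1 al u c2 z' d ai au lab Pc _ IH yd dc].
  by apply: near_leq; rewrite /width; lia.
case: (Pc) => [/(IH yd)//|/near_sym ye]; rewrite -yd.
exact: near_trans (near_trans dc (labels_near ai au lab)) ye.
Qed.

(** From [v] to another frontier point, then on to a cut point; the additional unit leaves room for
    one more letter in [cone_lift]. *)
Definition range := (width + (m + m)).+1.

Lemma near_ends_near v d0 d1 c : coned x0 v d0 -> coned x0 v d1 ->
  near_ends d0 d1 c -> near range v c.
Proof.
move=> /coned_near v0 /coned_near v1 [/(near_trans v0)|/(near_trans v1)];
  by apply: near_leq; rewrite /range.
Qed.

(** * Types of vertices and reconstruction of the cone *)

Definition labels_at v s t alpha : Prop :=
  exists c d, [/\ tr v s c, tr v t d & labels alpha c d].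
Definition coned_at v s : Prop := exists2 c, tr v s c & coned x0 v c.
Definition above_at v s : Prop := exists2 c, tr v s c & lvl v <= lvl c.

(** Short words from a vertex serve as coordinates on its ball, so the local data of two different
    vertices can be compared. *)
Definition same_type v v' : Prop :=
  [/\ forall s t alpha, size s <= range -> size t <= range -> alpha \in items g ->
        labels_at v s t alpha <-> labels_at v' s t alpha,
      forall s, size s <= range -> coned_at v s <-> coned_at v' s &
      forall s, size s <= range -> above_at v s <-> above_at v' s].

Lemma same_type_sym v v' : same_type v v' -> same_type v' v.
Proof. by move=> [lE cE aE]; split=> *; apply: iff_sym; auto. Qed.

Definition matched v v' c c' : Prop :=
  exists z, trace (above x0 (lvl v)) v z c /\ trace (above x0 (lvl v')) v' z c'.

Lemma matched_sym v v' c c' : matched v v' c c' -> matched v' v c' c.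
Proof. by move=> [z [vc vc']]; exists z. Qed.

Section SameType.
Variables v v' : G.
Hypothesis vv' : same_type v v'.

(** The empty form labels equal vertices only, so [labels_at v s s [::]] says that [s] can be read
    from [v]. *)
Lemma type_trace s c : size s <= range -> tr v s c -> exists c', tr v' s c'.
Proof.
move=> sr vc; have [lE _ _] := vv'.
have [|c' [_ [vc' _ _]]] := (lE s s [::] sr sr (items_nil g)).1; last by exists c'.
by exists c, c; split=> //; apply/labels_nil.
Qed.

Lemma type_labels s t c d c' d' alpha : size s <= range -> size t <= range ->
  alpha \in items g -> tr v s c -> tr v t d -> tr v' s c' -> tr v' t d' ->
  labels alpha c d -> labels alpha c' d'.
Proof.
move=> sr tR ai vc vd vc' vd' lab; have [lE _ _] := vv'.
have [|e [f [ve vf lab']]] := (lE s t alpha sr tR ai).1; first by exists c, d.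
by rewrite (trace_det vc' ve) (trace_det vd' vf).
Qed.

Lemma type_coned s c c' : size s <= range -> tr v s c -> tr v' s c' ->
  coned x0 v c -> coned x0 v' c'.
Proof.
move=> sr vc vc' cc; have [_ cE _] := vv'.
have [|e ve ce] := (cE s sr).1; first by exists c.
by rewrite (trace_det vc' ve).
Qed.

Lemma type_above s c c' : size s <= range -> tr v s c -> tr v' s c' ->
  lvl v <= lvl c -> lvl v' <= lvl c'.
Proof.
move=> sr vc vc' cc; have [_ _ aE] := vv'.
have [|e ve ce] := (aE s sr).1; first by exists c.
by rewrite (trace_det vc' ve).
Qed.

(** The cut points have coordinates within [range], so the type transfers each piece separately. *)
Lemma chain_transport P c z d s t c' d' :
  (forall e, P e -> near range v e) -> chain P c z d ->
  size s <= range -> size t <= range ->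
  tr v s c -> tr v t d -> tr v' s c' -> tr v' t d' -> tr c' z d'.
Proof.
move=> Pr cd; elim: cd s c' => [e|c1 al u c2 z' e ai au lab Pc _ IH] s c' sr tR vc vd vc' vd'.
  have := type_labels sr tR (items_nil g) vc vd vc' vd'.
  by rewrite !labels_nil; apply.
have [s2 s2r vc2] := Pr _ Pc; have [c2' vc2'] := type_trace s2r vc2.
apply/trace_catP; exists c2'; last exact: IH s2r tR vc2 vd vc2' vd'.
exact: (type_labels sr s2r ai vc vc2 vc' vc2').
Qed.

Lemma cone_transport d0 d1 s t d0' d1' z : coned x0 v d0 -> coned x0 v d1 ->
  trace (above x0 (lvl v)) d0 z d1 -> size s <= range -> size t <= range ->
  tr v s d0 -> tr v t d1 -> tr v' s d0' -> tr v' t d1' -> tr d0' z d1'.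
Proof.
move=> c0 c1 /(cone_chain c0 c1) dd; apply: chain_transport dd.
move=> e; exact: near_ends_near.
Qed.

Lemma loop_transport z : trace (above x0 (lvl v)) v z v -> tr v' z v'.
Proof.
by move=> vv; apply: (cone_transport (s := [::]) (t := [::])) vv _ _ _ _ _ _;
  rewrite //; apply: coned_refl.
Qed.

End SameType.

(** Two words leading from [v] to [c] in the cone combine to a loop at [v], and loops are
    transported. *)
Lemma matched_inj v v' c c' c'' : same_type v v' ->
  matched v v' c c' -> matched v v' c c'' -> c' = c''.
Proof.
move=> vv' [z [vc vc']] [w [vc1 vc1']].
have : trace (above x0 (lvl v)) v (z ++ word_inv w) v.
  by apply/trace_catP; exists c => //; apply: trace_sym vc1; apply: leqnn.
move=> /(loop_transport vv')/trace_catP[e /(trace_det vc') <-] c'v.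
exact: (trace_codet c'v (trace_sym (leqnn _) vc1')).
Qed.

Lemma matched_frontier v v' c c' : same_type v v' ->
  matched v v' c c' -> lvl c = lvl v -> lvl c' = lvl v'.
Proof.
move=> vv' [z [vc vc']] cv; have cc : coned x0 v c by split=> //; exists z.
have [t tw vt] := coned_near cc.
have tr' : size t <= range by rewrite /range; lia.
have [d vd] := type_trace vv' tr' vt.
have := cone_transport (s := [::]) vv' (coned_refl _ _) cc vc (leq0n _) tr' erefl vt erefl vd.
by move=> /(trace_det vc') ->; have [] := type_coned vv' tr' vt vd cc.
Qed.

(** The loop along the walk and back is transported, so the word can be read from [v']. What remains
    is that its last letter does not leave the cone of [v'], which could only happen from a frontier
    point [d']. *)
Lemma cone_lift v v' z c : same_type v v' -> trace (above x0 (lvl v)) v z c ->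
  exists c', trace (above x0 (lvl v')) v' z c'.
Proof.
move=> vv'; elim/last_ind: z c => [|z a IH] c; first by exists v'.
move=> vc; have : trace (above x0 (lvl v)) v (rcons z a ++ word_inv (rcons z a)) v.
  by apply/trace_catP; exists c => //; apply: trace_sym vc; apply: leqnn.
move=> /(loop_transport vv')/trace_catP[c' + _].
move: vc => /trace_rconsP[d [vd da dc]].
have [d' vd'] := IH _ vd; move=> /trace_rconsP[_ [/(trace_det vd') <- da' _]].
exists c'; apply/trace_rconsP; exists d'; split=> //.
have [cv'|v'c] := leqP (lvl d') (lvl v'); last first.
  by have := arrow_dist x0 (arrow_sym da'); rewrite /above; lia.
have v'd : coned x0 v' d'.
  split; last by exists z.
  apply/eqP; rewrite eqn_leq cv'.
  exact: (trace_last (P := above x0 (lvl v')) (leqnn _) vd').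
have v'v := same_type_sym vv'.
(* The short coordinate [t] of [d'] also leads from [v] to [d], so [above_at] can be compared on [t]
   followed by [a]. *)
have [t tw vt'] := coned_near v'd.
have tR : size t <= range by rewrite /range; lia.
have [e ve] := type_trace v'v tR vt'.
have := cone_transport (s := [::]) v'v (coned_refl _ _) v'd vd' (leq0n _) tR erefl vt' erefl ve.
move=> /(trace_det (trace_predT vd)) de; rewrite -de in ve.
apply: (type_above (s := rcons t a) (c := c) vv').
- by rewrite size_rcons /range; lia.
- by apply/trace_rconsP; exists d.
- by apply/trace_rconsP; exists d'.
- exact: dc.
Qed.

Lemma matched_arrow v v' y y' a e e' : same_type v v' ->
  matched v v' y y' -> matched v v' e e' -> arrow y a e -> arrow y' a e'.
Proof.
move=> vv' [z [vy vy']] vve ye; have [w [ve _]] := vve.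
have ze : trace (above x0 (lvl v)) v (rcons z a) e.
  apply/trace_rconsP; exists y; split=> //.
  exact: (trace_last (P := above x0 (lvl v)) (leqnn _) ve).
have [e'' ze'] := cone_lift vv' ze.
rewrite (matched_inj vv' vve (c'' := e'')); last by exists (rcons z a).
by move: ze' => /trace_rconsP[t [/(trace_det vy') <-]].
Qed.

Lemma end_isomorphic_same_type v v' : same_type v v' -> end_isomorphic x0 v v'.
Proof.
move=> vv'; have v'v := same_type_sym vv'.
have lift (p q c : G) : same_type p q -> cone x0 p c -> exists c', matched p q c c'.
  by move=> uu' [z uc]; have [c' uc'] := cone_lift uu' uc; exists c', z.
have matched_cone (p q c c' : G) : matched p q c c' -> cone x0 q c'.
  by move=> [z [_ uc]]; exists z.
have /choice[f fP] c : exists c', cone x0 v c -> matched v v' c c'.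
  have [/(lift _ _ _ vv')[c' cc']|nc] := pselect (cone x0 v c); first by exists c'.
  by exists c => /nc.
apply/end_isomorphicP; exists f; split=> [y /fP /matched_cone //|y /fP vy||y|y a e].
- split; first exact: matched_frontier vy.
  exact/(matched_frontier v'v)/matched_sym.
- move=> y e /fP vy /fP ve fye; rewrite -fye in ve.
  exact: (matched_inj v'v (matched_sym vy) (matched_sym ve)).
- move=> /(lift _ _ _ v'v)[c v'c]; have vc := matched_sym v'c.
  have cc := matched_cone _ _ _ _ v'c; exists c => //.
  exact: matched_inj vv' (fP _ cc) vc.
- move=> /fP vy /fP ve; split; first exact: matched_arrow vy ve.
  exact: (matched_arrow v'v (matched_sym vy) (matched_sym ve)).
Qed.

Notation ball := (range.-bseq (letter A)).

Definition cone_type v : {set ball * ball * 'I_(size (items g))} * {set ball} * {set ball} :=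
  (finset.finset (fun x : ball * ball * 'I_(size (items g)) =>
     `[< labels_at v x.1.1 x.1.2 (nth [::] (items g) x.2) >]),
   finset.finset (fun s : ball => `[< coned_at v s >]),
   finset.finset (fun s : ball => `[< above_at v s >])).

Lemma cone_typeP v v' : cone_type v = cone_type v' -> same_type v v'.
Proof.
move=> [/finset.setP lE /finset.setP cE /finset.setP aE].
split=> [s t alpha sr tR ai|s sr|s sr].
- have ia : index alpha (items g) < size (items g) by rewrite index_mem.
  move: (lE (Bseq sr, Bseq tR, Ordinal ia)); rewrite !finset.in_set /= nth_index //.
  exact: asbool_eq_equiv.
- by move: (cE (Bseq sr)); rewrite !finset.in_set /=; apply: asbool_eq_equiv.
- by move: (aE (Bseq sr)); rewrite !finset.in_set /=; apply: asbool_eq_equiv.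
Qed.

Lemma finite_cone_types : context_free_graph x0.
Proof.
pose T : finType := ({set ball * ball * 'I_(size (items g))} * {set ball} * {set ball})%type.
have /choice[r rP] (i : 'I_#|T|) : exists y, forall v,
    cone_type v = enum_val i -> end_isomorphic x0 v y.
  have [[y yE]|no] := pselect (exists y, cone_type y = enum_val i).
    exists y => v vE; apply/end_isomorphic_same_type/cone_typeP.
    by rewrite vE yE.
  by exists x0 => v vE; case: no; exists v.
exists #|T|, r => v; exists (enum_rank (cone_type v : T)); apply: rP.
by rewrite enum_rankK.
Qed.

End ConeTypes.

(** * Equivalence of the five descriptions of context-freeness *)

Lemma context_free_graph_of_lang (A : finType) (G : inverse_graph A) (x0 : G) :
  context_free_lang (walk_lang x0 [set x0]%classic) -> context_free_graph x0.
Proof.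
move=> [g gE]; have [m mP] := yield_bound (items g).
apply: finite_cone_types mP => w.
rewrite -cfg_langE gE walk_langE; split=> [[y -> //]|xx]; by exists x0.
Qed.

Theorem proposition7 (A : finType) (G : inverse_graph A) (x0 : G) :
  [<->
    (* (1) *)
    forall F : set G, (F !=set0)%classic -> finite_set F ->
      context_free_lang (walk_lang x0 F);
    (* (2) *)
    context_free_lang (walk_lang x0 [set x0]%classic);
    (* (3) *)
    context_free_graph x0;
    (* (4) *)
    exists (M : pda A) (Minv : inverse_pda M),
      rooted_isomorphic (conf_root Minv) x0;
    (* (5) *)
    forall y0 : G, context_free_graph y0].
Proof.
tfae=> [cfF|cf|cf|[M [Minv]] /coding_of_iso[code codeP] y0|cf F _ Ffin].
- by apply: cfF; [exists x0 | apply: finite_set1].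
- exact: context_free_graph_of_lang.
- have [M [code codeP]] := coding_of_context_free cf.
  by exists M, (coding_inverse codeP); apply: iso_of_coding.
(* The automaton for the root [x0] also yields a grammar for the loops at [y0], to which the passage
   from languages to cones applies. *)
- apply: context_free_graph_of_lang.
  exact: walk_lang_context_free codeP (finite_set1 y0).
- have [M [code codeP]] := coding_of_context_free (cf x0).
  exact: walk_lang_context_free codeP Ffin.
Qed.
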